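(* Fix a Dedekind real $b\in(1,\infty)$. Then one can define one-sided logarithm maps $$\log_b\colon \overrightarrow{[0,\infty]}\rightarrow\overrightarrow{[-\infty,\infty]}\quad\text{and}\quad \log_b\colon\overleftarrow{[0,\infty]}\rightarrow\overleftarrow{[-\infty,\infty]}$$ inverse to the corresponding exponentiation maps $b^{(-)}\colon\overrightarrow{[-\infty,\infty]}\to\overrightarrow{[0,\infty]}$ and $b^{(-)}\colon\overleftarrow{[-\infty,\infty]}\to\overleftarrow{[0,\infty]}$ on the one-sided reals. These combine (taking the lower log of the left section and the upper log of the right section) to yield an isomorphism on the Dedekind reals $$\log_b\colon(0,\infty)\xrightarrow{\ \sim\ }(-\infty,\infty).$$
   Context: All spaces are point-free and the development is geometric. $\mathbf{Spaces}$ is the opposite of the category of frames and frame homomorphisms; its objects are (localic) spaces, each presented by a propositional geometric theory whose models are its points; its morphisms are maps, equivalently geometric constructions of points of the codomain from (generalised) points of the domain. ''Fix $b\in(1,\infty)$'' means working over the space $(1,\infty)$ (with $b$ its generic point), so that a map $A\to B$ constructed for fixed $b$ is the same as a map $(1,\infty)\times A\to B$. A Dedekind real is a pair $x=(L_x,R_x)$ of subsets of $\mathbb{Q}$ (write $q<x$ for $q\in L_x$, $x<r$ for $r\in R_x$) such that both are inhabited; $q\in L_x$ iff there is $q'>q$ with $q'\in L_x$; $r\in R_x$ iff there is $r'<r$ with $r'\in R_x$; $q\in L_x$ and $r\in R_x$ imply $q<r$; and $q<r$ implies $q\in L_x$ or $r\in R_x$. $\mathbb{R}=(-\infty,\infty)$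 is the space of these; $(0,\infty)$ and $(1,\infty)$ are the open subspaces $0<x$ and $1<x$. A lower real is a subset $L\subseteq\mathbb{Q}$ with $q\in L\Leftrightarrow\exists q'>q.\,q'\in L$ (possibly empty, $=-\infty$, or all of $\mathbb{Q}$, $=\infty$); an upper real is a subset $R\subseteq\mathbb{Q}$ with $r\in R\Leftrightarrow\exists r'<r.\,r'\in R$ (possibly empty, $=\infty$, or all of $\mathbb{Q}$, $=-\infty$). Write $q<x$ for membership in a lower real and $x<r$ for membership in an upper real. $\overrightarrow{[-\infty,\infty]}$ and $\overleftarrow{[-\infty,\infty]}$ are the spaces of all lower, respectively upper, reals (Scott topology, generated by the membership propositions); $\overrightarrow{[0,\infty]}$ is the subspace of lower reals containing all negative rationals, and $\overleftarrow{[0,\infty]}$ the subspace of upper reals all of whose elements are positive. For $q\in\mathbb{Q}$, $b^q$ is the usual rational power: repeated multiplication for natural exponents, $b^{1/n}$ is the unique positive Dedekind real whose $n$-th power is $b$, $b^{m/n}=(b^m)^{1/n}$, and $b^{-q}=(b^q)^{-1}$. For one-sided exponents: if $\zeta$ is a lower real, $b^{\zeta}$ is the lower real given by $q<b^{\zeta}\Leftrightarrow q<0\lor\exists q'\in\mathbb{Q}.(q'<\zeta\land q<b^{q'})$; if $\zeta$ is an upper real, $b^\zeta$ is the upper real given by $q>b^{\zeta}\Leftrightarrow\exists q'\in\mathbb{Q}.(q'>\zeta\land q>b^{q'})$. For a Dedekind $\zeta$, $b^\zeta=(b^{L_\zeta},b^{R_\zeta})$, and the isomorphism in the claim is inverse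 to this $b^{(-)}$. *)

(* Defs.v *)
From mathcomp Require Import all_boot all_order all_algebra.
From mathcomp Require Import boolp ring lra.
Set Implicit Arguments.
Unset Strict Implicit.
Unset Printing Implicit Defensive.
Import Order.TTheory GRing.Theory Num.Theory.
Local Open Scope ring_scope.

Local Obligation Tactic := idtac.

Record frame := Frame {
  opens :> Type;
  fle : opens -> opens -> Prop;
  ftop : opens;
  fmeet : opens -> opens -> opens;
  fsup : (opens -> Prop) -> opens;
  fle_refl : forall u, fle u u;
  fle_trans : forall u v w, fle u v -> fle v w -> fle u w;
  fle_anti : forall u v, fle u v -> fle v u -> u = v;
  fle_top : forall u, fle u ftop;
  fle_meetP : forall u v w, fle u (fmeet v w) <-> fle u v /\ fle u w;
  fsup_leP : forall (S : opens -> Prop) u,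
    fle (fsup S) u <-> (forall v, S v -> fle v u);
  fmeet_supr : forall u (S : opens -> Prop),
    fmeet u (fsup S) = fsup (fun w => exists2 v, S v & w = fmeet u v)
}.

Arguments opens : simpl never.
Arguments fle {f} : simpl never.
Arguments ftop {f} : simpl never.
Arguments fmeet {f} : simpl never.
Arguments fsup {f} : simpl never.
Arguments fle_refl {f}.

(* Geometric logic in a frame; [\tv P] is the truth value of the external
   proposition P. *)
Definition fjoin (X : frame) (u v : X) : X := fsup (fun w => w = u \/ w = v).
Definition ftruth (X : frame) (P : Prop) : X := fsup (fun w => P /\ w = ftop).
Definition fexists (X : frame) (I : Type) (f : I -> X) : X :=
  fsup (fun w => exists i, w = f i).

Declare Scope frame_scope.
Delimit Scope frame_scope with F.
Notation "u |-- v" := (fle u v) (at level 70, no associativity) : frame_scope.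
Notation "u :&: v" := (fmeet u v) : frame_scope.
Notation "u :|: v" := (fjoin u v) : frame_scope.
Notation "\tv P" := (ftruth _ P) (at level 10, P at level 8) : frame_scope.
Notation "\ex i , f" := (fexists (fun i => f))
  (at level 200, i name, f at level 200) : frame_scope.
Local Open Scope frame_scope.

Record frame_hom (X Y : frame) := FrameHom {
  hom_fun :> X -> Y;
  hom_top : hom_fun ftop = ftop;
  hom_meet : forall u v, hom_fun (u :&: v) = hom_fun u :&: hom_fun v;
  hom_sup : forall S : X -> Prop,
    hom_fun (fsup S) = fsup (fun w => exists2 v, S v & w = hom_fun v)
}.

Lemma hom_ext (X Y : frame) (f g : frame_hom X Y) : f =1 g -> f = g.
Proof.
case: f => f f1 f2 f3; case: g => g g1 g2 g3 /= /funext fg.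
by case: g / fg g1 g2 g3 => *; congr FrameHom; exact: Prop_irrelevance.
Qed.

(* The category of spaces is the opposite of the category of frames: a map
   X -> Y is its inverse image homomorphism. *)
Definition space := frame.
Definition smap (X Y : space) := frame_hom Y X.

Program Definition id_map (X : space) : smap X X := @FrameHom X X id _ _ _.
Next Obligation. by []. Qed.
Next Obligation. by []. Qed.
Next Obligation.
by move=> X S; congr fsup; apply/funext => w; apply/propext; split;
  [exists w | case=> v Sv ->].
Qed.

Program Definition scomp (X Y Z : space) (g : smap Y Z) (f : smap X Y) : smap X Z :=
  @FrameHom Z X (f \o g) _ _ _.
Next Obligation. by move=> *; rewrite /= !hom_top. Qed.
Next Obligation. by move=> *; rewrite /= !hom_meet. Qed.
Next Obligation.
move=> X Y Z g f S; rewrite /= !hom_sup; congr fsup; apply/funext => w.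
apply/propext; split; first by case=> v [v' Sv' ->] ->; exists v'.
by case=> v Sv ->; exists (g v) => //; exists v.
Qed.

Lemma scompE (X Y Z : space) (g : smap Y Z) (f : smap X Y) (u : Z) :
  scomp g f u = f (g u).
Proof. by []. Qed.

Section FrameTheory.
Variable X : frame.
Implicit Types u v w a b z : X.

Lemma meetl u v : u :&: v |-- u.
Proof. by have /fle_meetP[] := fle_refl (u :&: v). Qed.

Lemma meetr u v : u :&: v |-- v.
Proof. by have /fle_meetP[] := fle_refl (u :&: v). Qed.

Lemma meetI u a b : u |-- a -> u |-- b -> u |-- a :&: b.
Proof. by move=> ua ub; apply/fle_meetP. Qed.

Lemma meetE1 u a b : u |-- a :&: b -> u |-- a.
Proof. by case/fle_meetP. Qed.

Lemma meetE2 u a b : u |-- a :&: b -> u |-- b.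
Proof. by case/fle_meetP. Qed.

Lemma supI u (S : X -> Prop) a : S a -> u |-- a -> u |-- fsup S.
Proof.
move=> Sa ua; apply: fle_trans ua _.
by have /fsup_leP := fle_refl (fsup S); apply.
Qed.

(* Elimination rules are stated in Kripke-Joyal style: the context u is
   refined to a smaller w. *)
Lemma supE u (S : X -> Prop) z : u |-- fsup S ->
  (forall a, S a -> forall w, w |-- u -> w |-- a -> w |-- z) -> u |-- z.
Proof.
move=> uS H; apply: fle_trans (meetI (fle_refl u) uS) _.
rewrite fmeet_supr; apply/fsup_leP => _ [v Sv ->].
by apply: (H v) => //; [exact: meetl | exact: meetr].
Qed.

Lemma joinIl u a b : u |-- a -> u |-- a :|: b.
Proof. by apply: supI; left. Qed.

Lemma joinIr u a b : u |-- b -> u |-- a :|: b.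
Proof. by apply: supI; right. Qed.

Lemma joinE u a b z : u |-- a :|: b ->
  (forall w, w |-- u -> w |-- a -> w |-- z) ->
  (forall w, w |-- u -> w |-- b -> w |-- z) -> u |-- z.
Proof. by move=> /supE H Ha Hb; apply: H => _ [->|->]. Qed.

Lemma tvI u (P : Prop) : P -> u |-- \tv P.
Proof. by move=> p; apply: (@supI _ _ ftop) => //; exact: fle_top. Qed.

Lemma tvE u (P : Prop) z : u |-- \tv P -> (P -> u |-- z) -> u |-- z.
Proof.
by move=> /supE H Hz; apply: H => _ [p _] w wu _; apply: fle_trans wu (Hz p).
Qed.

Lemma exI (I : Type) (i : I) u (f : I -> X) : u |-- f i -> u |-- \ex i, f i.
Proof. by apply: supI; exists i. Qed.

Lemma exE (I : Type) u (f : I -> X) z : u |-- (\ex i, f i) ->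
  (forall i w, w |-- u -> w |-- f i -> w |-- z) -> u |-- z.
Proof. by move=> /supE H Hz; apply: H => _ [i ->]; apply: Hz. Qed.

End FrameTheory.

(* Propositional geometric theories.  A sequent [axiom l D] reads: the
   conjunction of the atoms in l entails the disjunction, over d in D, of the
   conjunctions of the atoms in d. *)

Record theory := Theory {
  atom : eqType;
  axiom : seq atom -> (seq atom -> Prop) -> Prop
}.

Definition fconj (X : frame) (A : Type) (v : A -> X) (l : seq A) : X :=
  foldr (fun a u => v a :&: u) ftop l.

Definition satisfies (X : frame) (A : Type) (v : A -> X)
    (l : seq A) (D : seq A -> Prop) : Prop :=
  fconj v l |-- fsup (fun w => exists2 d, D d & w = fconj v d).

(* A generalised point of [T] at the stage X: a model of T in the frame X. *)
Record pt (X : space) (T : theory) := Pt {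
  pt_val :> atom T -> X;
  pt_sat : forall l D, axiom l D -> satisfies pt_val l D
}.

Lemma pt_ext (X : space) (T : theory) (p q : pt X T) : p =1 q -> p = q.
Proof.
case: p => p p1; case: q => q q1 /= /funext pq.
by case: q / pq q1 => *; congr Pt; exact: Prop_irrelevance.
Qed.

Section Conj.
Variables (X : frame) (A : eqType) (v : A -> X).
Implicit Types (l d : seq A) (D : seq A -> Prop).

Lemma conjI u l : (forall a, a \in l -> u |-- v a) -> u |-- fconj v l.
Proof.
elim: l => [|a l IH] H /=; first exact: fle_top.
apply: meetI; first by apply: H; rewrite inE eqxx.
by apply: IH => b bl; apply: H; rewrite inE bl orbT.
Qed.

Lemma conjE u l a : a \in l -> u |-- fconj v l -> u |-- v a.
Proof.
elim: l => [//|b l IH]; rewrite inE => /orP[/eqP-> /meetE1 //|al /meetE2].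
exact: IH.
Qed.

Lemma satI l D :
  (forall u, (forall a, a \in l -> u |-- v a) ->
    forall z, (forall d w, D d -> w |-- u -> (forall a, a \in d -> w |-- v a) ->
      w |-- z) -> u |-- z) ->
  satisfies v l D.
Proof.
move=> H; apply: H => [a al|d w Dd _ Hw]; first exact: conjE al (fle_refl _).
by apply: (@supI _ _ _ (fconj v d)); [exists d | exact: conjI].
Qed.

Lemma satE l D u z : satisfies v l D -> (forall a, a \in l -> u |-- v a) ->
  (forall d w, D d -> w |-- u -> (forall a, a \in d -> w |-- v a) -> w |-- z) ->
  u |-- z.
Proof.
move=> sv Hu Hz; have uD := fle_trans (conjI Hu) sv.
apply: supE uD _ => _ [d Dd ->] w wu wd; apply: (Hz d) => // a ad.
exact: conjE ad wd.
Qed.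

End Conj.

(* The space presented by a theory.  Its opens are the ideals of finite
   conjunctions of atoms (as sequences: longer is smaller) that are closed
   under the coverage generated by the axioms; the lemmas classify_atom and
   map_eqP below give its universal property. *)

Section Presentation.
Variable T : theory.
Implicit Types (l m d : seq (atom T)) (S : seq (atom T) -> Prop).

Record ideal := Ideal {
  ideal_mem :> seq (atom T) -> Prop;
  ideal_sub : forall l m, {subset l <= m} -> ideal_mem l -> ideal_mem m;
  ideal_cov : forall l D m, axiom l D ->
    (forall d, D d -> ideal_mem (m ++ d)) -> ideal_mem (m ++ l)
}.

Lemma ideal_ext (I J : ideal) : (forall l, I l <-> J l) -> I = J.
Proof.
case: I => I I1 I2; case: J => J J1 J2 /= IJ.
have {}IJ : I = J by apply/funext => l; exact/propext.
by case: J / IJ J1 J2 => *; congr Ideal; exact: Prop_irrelevance.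
Qed.

Program Definition ideal_gen S : ideal :=
  @Ideal (fun l => forall J : ideal, (forall m, S m -> J m) -> J l) _ _.
Next Obligation. by move=> S l m lm Hl J HJ; apply: ideal_sub lm (Hl J HJ). Qed.
Next Obligation.
move=> S l D m ax H J HJ; apply: ideal_cov ax _ => d Dd; exact: H.
Qed.

Program Definition ideal_top : ideal := @Ideal (fun=> True) _ _.
Solve All Obligations with done.

Program Definition ideal_meet (I J : ideal) : ideal :=
  @Ideal (fun l => I l /\ J l) _ _.
Next Obligation. by move=> I J l m lm [Il Jl]; split; apply: ideal_sub lm _. Qed.
Next Obligation.
by move=> I J l D m ax H; split; apply: ideal_cov ax _ => d /H[].
Qed.

(* Heyting implication with the principal ideal of l as antecedent. *)
Program Definition ideal_imp l (K : ideal) : ideal :=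
  @Ideal (fun m => K (m ++ l)) _ _.
Next Obligation.
move=> l K m n mn; apply: ideal_sub => a; rewrite !mem_cat => /orP[/mn->//|->].
by rewrite orbT.
Qed.
Next Obligation.
move=> l K a D m ax H; apply: (@ideal_sub K ((m ++ l) ++ a)).
  by move=> x; rewrite !mem_cat => /orP[/orP[]|] ->; rewrite ?orbT.
apply: ideal_cov ax _ => d /H; apply: ideal_sub.
by move=> x; rewrite !mem_cat => /orP[/orP[]|] ->; rewrite ?orbT.
Qed.

Lemma sub_catl l m : {subset l <= l ++ m}.
Proof. by move=> x xl; rewrite mem_cat xl. Qed.

Lemma sub_catr l m : {subset m <= l ++ m}.
Proof. by move=> x xm; rewrite mem_cat xm orbT. Qed.

Lemma sub_catid l : {subset l ++ l <= l}.
Proof. by move=> x; rewrite mem_cat orbb. Qed.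

Lemma ideal_genP S l : S l -> ideal_gen S l.
Proof. by move=> Sl J; apply. Qed.

Program Definition Sp : space :=
  @Frame ideal (fun I J => forall l, I l -> J l) ideal_top ideal_meet
    (fun S : ideal -> Prop =>
       ideal_gen (fun l => exists2 I, S I & ideal_mem I l)) _ _ _ _ _ _ _.
Next Obligation. by []. Qed.
Next Obligation. by move=> I J K IJ JK l /IJ/JK. Qed.
Next Obligation. by move=> I J IJ JI; apply: ideal_ext => l; split; auto. Qed.
Next Obligation. by []. Qed.
Next Obligation.
move=> I J K; split; last by case=> IJ IK l Il /=; auto.
by move=> H; split=> l /H[].
Qed.
Next Obligation.
move=> S K; split=> [H I SI l Il|H l /(_ K)]; last by apply=> m [I /H]; apply.
by apply: H => J; apply; exists I.
Qed.
Next Obligation.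
move=> I S; apply: ideal_ext => l; split=> /=; last first.
  move=> H; apply: (H (ideal_meet I (ideal_gen _))) => m [_ [J SJ ->]] [Im Jm].
  by split=> //; apply: ideal_genP; exists J.
move=> [Il Sl] K HK; apply: ideal_sub (@sub_catid l) _.
apply: (Sl (ideal_imp l K)) => m [J SJ Jm] /=.
apply: HK; exists (ideal_meet I J); first by exists J.
split; first exact: ideal_sub (@sub_catr m l) Il.
exact: ideal_sub (@sub_catl m l) Jm.
Qed.

Definition principal l : Sp := ideal_gen (fun m => m = l).

Lemma principalP l (I : Sp) : principal l |-- I <-> ideal_mem I l.
Proof.
split=> [|Il m /(_ I)]; first by apply; apply: ideal_genP.
by apply=> _ ->.
Qed.

Lemma principal_cat l m : principal l :&: principal m = principal (l ++ m).
Proof.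
apply: fle_anti; last first.
  apply: meetI; apply/principalP.
  - by apply: ideal_sub (@sub_catl l m) _; exact: ideal_genP.
  - by apply: ideal_sub (@sub_catr l m) _; exact: ideal_genP.
move=> x [xl xm]; pose K : ideal := principal (l ++ m).
apply: (@ideal_sub K _ _ (@sub_catid x)); apply: (xl (ideal_imp x K)) => _ ->.
apply: (@ideal_sub K (x ++ l)) => [a|]; first by rewrite !mem_cat orbC.
apply: (xm (ideal_imp l K)) => _ ->; apply: (@ideal_sub K (l ++ m)).
  by move=> a; rewrite !mem_cat orbC.
exact: ideal_genP.
Qed.

Lemma conj_principal l : fconj (fun a => principal [:: a]) l = principal l.
Proof.
elim: l => [|a l IH] /=; last by rewrite IH principal_cat.
apply: fle_anti; last exact: fle_top.
by move=> l _; apply: (@ideal_sub _ [::]) => //; exact: ideal_genP.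
Qed.

Lemma generic_sat l D : axiom l D -> satisfies (fun a => principal [:: a]) l D.
Proof.
move=> ax; rewrite /satisfies conj_principal; apply/principalP.
apply: (ideal_cov (m := [::])) ax _ => d Dd; apply: ideal_genP.
by exists (principal d); [exists d; rewrite ?conj_principal | exact: ideal_genP].
Qed.

Definition generic : pt Sp T := Pt generic_sat.

Lemma open_sup (I : Sp) : I = fsup (fun w => exists2 l, ideal_mem I l & w = principal l).
Proof.
apply: fle_anti; last by apply/fsup_leP => _ [l Il ->]; apply/principalP.
move=> l Il; apply: ideal_genP; exists (principal l); last exact: ideal_genP.
by exists l.
Qed.

Section Classify.
Variables (X : space) (p : pt X T).

Definition classify_fun (I : Sp) : X :=
  fsup (fun w => exists2 l, ideal_mem I l & w = fconj p l).

Lemma classify_leP (I : Sp) z :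
  classify_fun I |-- z <-> forall l, ideal_mem I l -> fconj p l |-- z.
Proof.
split=> [/fsup_leP H l Il|H]; first by apply: H; exists l.
by apply/fsup_leP => _ [l Il ->]; exact: H.
Qed.

Program Definition lower_ideal (z : X) : ideal :=
  @Ideal (fun l => fconj p l |-- z) _ _.
Next Obligation.
move=> z l m lm; apply: fle_trans; apply: conjI => a /lm am.
exact: conjE am (fle_refl _).
Qed.
Next Obligation.
move=> z l D m ax H; apply: (satE (pt_sat p ax)) => [a al|d w Dd wml wd].
  by apply: conjE (fle_refl _); rewrite mem_cat al orbT.
apply: fle_trans (H d Dd); apply: conjI => a; rewrite mem_cat => /orP[am|/wd//].
by apply: fle_trans wml (conjE _ (fle_refl _)); rewrite mem_cat am.
Qed.

Lemma classify_top : classify_fun ftop = ftop.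
Proof.
apply: fle_anti; first exact: fle_top.
by apply: (@supI _ _ _ ftop); [exists [::] | exact: fle_refl].
Qed.

Lemma classify_meet I J : classify_fun (I :&: J) = classify_fun I :&: classify_fun J.
Proof.
apply: fle_anti.
  by apply/classify_leP => l [Il Jl]; apply: meetI; (apply: supI; first by exists l);
     exact: fle_refl.
apply: supE (meetl _ _) _ => _ [l Il ->] w wIJ wl.
apply: supE (fle_trans wIJ (meetr _ _)) _ => _ [m Jm ->] w' w'w w'm.
apply: (@supI _ _ _ (fconj p (l ++ m))).
  exists (l ++ m) => //; split; first exact: ideal_sub (@sub_catl l m) Il.
  exact: ideal_sub (@sub_catr l m) Jm.
apply: conjI => a; rewrite mem_cat => /orP[al|am]; last exact: conjE am w'm.
exact: conjE al (fle_trans w'w wl).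
Qed.

Lemma classify_sup (S : Sp -> Prop) :
  classify_fun (fsup S) = fsup (fun w => exists2 I, S I & w = classify_fun I).
Proof.
apply: fle_anti; last first.
  apply/fsup_leP => _ [I SI ->]; apply/classify_leP => l Il.
  apply: (@supI _ _ _ (fconj p l)); last exact: fle_refl.
  by exists l => //; apply: ideal_genP; exists I.
apply/classify_leP => l Sl; apply: (Sl (lower_ideal _)) => m [I SI Im] /=.
apply: (@supI _ _ _ (classify_fun I)); first by exists I.
by apply: (@supI _ _ _ (fconj p m)); [exists m | exact: fle_refl].
Qed.

Definition classify : smap X Sp :=
  FrameHom classify_top classify_meet classify_sup.

Lemma classify_atom a : classify (generic a) = p a.
Proof.
apply: fle_anti.
  apply/classify_leP => l /(_ (lower_ideal (p a))); apply=> _ -> /=.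
  exact: meetl.
apply: (@supI _ _ _ (fconj p [:: a])).
  by exists [:: a] => //; exact: ideal_genP.
by apply: meetI; [exact: fle_refl | exact: fle_top].
Qed.

End Classify.

Lemma hom_conj (X Y : frame) (f : frame_hom X Y) (A : Type) (v : A -> X) (l : seq A) :
  f (fconj v l) = fconj (f \o v) l.
Proof. by elim: l => [|a l IH] /=; rewrite ?hom_top // hom_meet IH. Qed.

Lemma map_eqP (X : space) (f g : smap X Sp) :
  (forall a, f (generic a) = g (generic a)) -> f = g.
Proof.
move=> fg; apply: hom_ext => I; rewrite (open_sup I) !hom_sup.
congr fsup; apply/funext => w; apply/propext.
have E l : f (principal l) = g (principal l).
  rewrite -conj_principal !hom_conj; elim: l => //= a l ->.
  by congr (_ :&: _); exact: fg.
by split=> -[_ [l Il ->] ->]; exists (principal l); rewrite ?E //; exists l.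
Qed.

End Presentation.

Arguments generic T : simpl never, clear implicits.
Arguments classify {T X} p : simpl never.

Lemma pull_sat (X Y : space) (T : theory) (f : smap X Y) (p : pt Y T) l D :
  axiom l D -> satisfies (f \o p) l D.
Proof.
move=> ax; apply: satI => u Hu z Hz.
have fE d : fconj (f \o p) d = f (fconj p d) by rewrite hom_conj.
have: f (fconj p l) |-- f (fsup (fun w => exists2 d, D d & w = fconj p d)).
  have := pt_sat p ax; rewrite /satisfies; set c := fconj _ _ => cD.
  have -> : c = c :&: fsup (fun w => exists2 d, D d & w = fconj p d).
    by apply: fle_anti; [apply: meetI => //; exact: fle_refl | exact: meetl].
  by rewrite hom_meet; exact: meetr.
rewrite hom_sup -fE => H; apply: supE (fle_trans (conjI Hu) H) _.
move=> _ [_ [d Dd ->] ->] w wu wd; apply: (Hz d w) => // a ad.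
by apply: conjE ad _; rewrite fE.
Qed.

Definition pull (X Y : space) (T : theory) (f : smap X Y) (p : pt Y T) : pt X T :=
  Pt (pull_sat f p).

Inductive prod_axiom (A B : theory) : seq (atom A + atom B)%type ->
    (seq (atom A + atom B)%type -> Prop) -> Prop :=
| prod_axiom_l l D : axiom l D -> prod_axiom (map inl l)
    (fun d => exists2 d', D d' & d = map inl d')
| prod_axiom_r l D : axiom l D -> prod_axiom (map inr l)
    (fun d => exists2 d', D d' & d = map inr d').

(* The theory of pairs of a model of A and a model of B: it presents the
   product space. *)
Definition prodT (A B : theory) : theory := Theory (@prod_axiom A B).

Section Product.
Variables (X : space) (A B : theory).

Lemma fst_sat (p : pt X (prodT A B)) l D :
  axiom l D -> satisfies (fun a => p (inl a)) l D.
Proof.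
move=> ax; apply: satI => u Hu z Hz.
apply: (satE (pt_sat p (prod_axiom_l _ ax))) => [_ /mapP[a al ->]|]; first exact: Hu.
move=> _ w [d Dd ->] wu Hd; apply: (Hz d) => // a ad.
by apply: Hd; apply/mapP; exists a.
Qed.

Lemma snd_sat (p : pt X (prodT A B)) l D :
  axiom l D -> satisfies (fun a => p (inr a)) l D.
Proof.
move=> ax; apply: satI => u Hu z Hz.
apply: (satE (pt_sat p (prod_axiom_r _ ax))) => [_ /mapP[a al ->]|]; first exact: Hu.
move=> _ w [d Dd ->] wu Hd; apply: (Hz d) => // a ad.
by apply: Hd; apply/mapP; exists a.
Qed.

Definition pt_fst (p : pt X (prodT A B)) : pt X A := Pt (fst_sat p).
Definition pt_snd (p : pt X (prodT A B)) : pt X B := Pt (snd_sat p).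

Definition pair_val (p : pt X A) (q : pt X B) (a : atom (prodT A B)) : X :=
  match a with inl a => p a | inr a => q a end.

Lemma pair_sat p q l D : axiom l D -> satisfies (pair_val p q) l D.
Proof.
case=> {}l {}D ax; apply: satI => u Hu z Hz.
  apply: (satE (pt_sat p ax)) => [a al|d w Dd wu Hd].
    exact: (Hu (inl a) (map_f inl al)).
  by apply: (Hz (map inl d) w) => // [|_ /mapP[a ad ->]]; [exists d | exact: Hd].
apply: (satE (pt_sat q ax)) => [a al|d w Dd wu Hd].
  exact: (Hu (inr a) (map_f inr al)).
by apply: (Hz (map inr d) w) => // [|_ /mapP[a ad ->]]; [exists d | exact: Hd].
Qed.

Definition pt_pair (p : pt X A) (q : pt X B) : pt X (prodT A B) :=
  Pt (pair_sat p q).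

End Product.

Definition fst_map (A B : theory) : smap (Sp (prodT A B)) (Sp A) :=
  classify (pt_fst (generic (prodT A B))).

Definition snd_map (A B : theory) : smap (Sp (prodT A B)) (Sp B) :=
  classify (pt_snd (generic (prodT A B))).

Definition pair_map (X : space) (A B : theory) (f : smap X (Sp A))
    (g : smap X (Sp B)) : smap X (Sp (prodT A B)) :=
  classify (pt_pair (pull f (generic A)) (pull g (generic B))).

Lemma fst_pair_map (X : space) (A B : theory) (f : smap X (Sp A))
  (g : smap X (Sp B)) : scomp (fst_map A B) (pair_map f g) = f.
Proof.
apply: map_eqP => a; rewrite scompE classify_atom.
exact: (@classify_atom (prodT A B) X (pt_pair _ _) (inl a)).
Qed.

Lemma snd_pair_map (X : space) (A B : theory) (f : smap X (Sp A))
  (g : smap X (Sp B)) : scomp (snd_map A B) (pair_map f g) = g.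
Proof.
apply: map_eqP => a; rewrite scompE classify_atom.
exact: (@classify_atom (prodT A B) X (pt_pair _ _) (inr a)).
Qed.

Lemma pair_map_eta (X : space) (A B : theory) (h : smap X (Sp (prodT A B))) :
  pair_map (scomp (fst_map A B) h) (scomp (snd_map A B) h) = h.
Proof.
by apply: map_eqP => -[a|a]; rewrite classify_atom [LHS]scompE classify_atom.
Qed.

(* Working over a fixed base S, a map A -> B is a map S * A -> B. *)
Definition map_over (S A B : theory) := smap (Sp (prodT S A)) (Sp B).

Definition const_over (S A B : theory) (f : smap (Sp A) (Sp B)) :
  map_over S A B := scomp f (snd_map S A).

Definition id_over (S A : theory) : map_over S A A := snd_map S A.

Definition comp_over (S A B C : theory) (g : map_over S B C)
    (f : map_over S A B) : map_over S A C :=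
  scomp g (pair_map (fst_map S A) f).

Definition inverse_over (S A B : theory) (f : map_over S A B)
    (g : map_over S B A) : Prop :=
  comp_over f g = id_over S B /\ comp_over g f = id_over S A.

(* One-sided and Dedekind reals.  An atom q of the lower reals reads q < x,
   an atom r of the upper reals reads x < r; the Dedekind reals have the
   atoms inl q (q < x) and inr r (x < r). *)

Inductive lower_axiom : seq rat -> (seq rat -> Prop) -> Prop :=
| lower_down q q' : q < q' -> lower_axiom [:: q'] (fun d => d = [:: q])
| lower_round q :
    lower_axiom [:: q] (fun d => exists2 q', q < q' & d = [:: q']).

Inductive upper_axiom : seq rat -> (seq rat -> Prop) -> Prop :=
| upper_up r r' : r' < r -> upper_axiom [:: r'] (fun d => d = [:: r])
| upper_round r :
    upper_axiom [:: r] (fun d => exists2 r', r' < r & d = [:: r']).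

Inductive real_axiom :
    seq (rat + rat)%type -> (seq (rat + rat)%type -> Prop) -> Prop :=
| real_inhL : real_axiom [::] (fun d => exists q, d = [:: inl q])
| real_inhR : real_axiom [::] (fun d => exists r, d = [:: inr r])
| real_lower l D : lower_axiom l D -> real_axiom (map inl l)
    (fun d => exists2 d', D d' & d = map inl d')
| real_upper l D : upper_axiom l D -> real_axiom (map inr l)
    (fun d => exists2 d', D d' & d = map inr d')
| real_disj q r :
    real_axiom [:: inl q; inr r] (fun d => q < r /\ d = [::])
| real_loc q r : q < r ->
    real_axiom [::] (fun d => d = [:: inl q] \/ d = [:: inr r]).

Definition LowerR : theory := Theory lower_axiom.
Definition UpperR : theory := Theory upper_axiom.
Definition RealT : theory := Theory real_axiom.

Definition subT (T : theory)
    (E : seq (atom T) -> (seq (atom T) -> Prop) -> Prop) : theory :=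
  @Theory (atom T) (fun l D => axiom l D \/ E l D).

Inductive contains_negatives : seq rat -> (seq rat -> Prop) -> Prop :=
| ContainsNegative q : q < 0 -> contains_negatives [::] (fun d => d = [:: q]).

Inductive all_positive : seq rat -> (seq rat -> Prop) -> Prop :=
| AllPositive r : all_positive [:: r] (fun d => 0 < r /\ d = [::]).

Inductive greater_than (q : rat) :
    seq (rat + rat)%type -> (seq (rat + rat)%type -> Prop) -> Prop :=
| GreaterThan : greater_than q [::] (fun d => d = [:: inl q]).

Definition LowerNN : theory := @subT LowerR contains_negatives.
Definition UpperNN : theory := @subT UpperR all_positive.
Definition PosReal : theory := @subT RealT (greater_than 0).
Definition GtOneReal : theory := @subT RealT (greater_than 1).

Ltac ctx Hwu :=
  match type of Hwu with fle ?w ?u =>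
    repeat match goal with H : fle u _ |- _ =>
      move: (fle_trans Hwu H) => {}H end;
    clear Hwu; try clear u
  end.

Section Lower.
Variables (X : space) (v : rat -> X).

Record is_lower : Prop := IsLower {
  lowerD : forall q q' u, q < q' -> u |-- v q' -> u |-- v q;
  lowerR : forall q u, u |-- v q -> u |-- \ex q', \tv (q < q') :&: v q'
}.

Record is_upper : Prop := IsUpper {
  upperD : forall r r' u, r' < r -> u |-- v r' -> u |-- v r;
  upperR : forall r u, u |-- v r -> u |-- \ex r', \tv (r' < r) :&: v r'
}.

Lemma lower_satP : (forall l D, lower_axiom l D -> satisfies v l D) <-> is_lower.
Proof.
split=> [sat|[vD vR] _ _ [q q' qq'|q]].
- split=> [q q' u qq' uq'|q u uq].
    apply: (satE (sat _ _ (lower_down qq'))) => [a|_ w -> _ Hw].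
      by rewrite inE => /eqP->.
    by apply: Hw; rewrite inE.
  apply: (satE (sat _ _ (lower_round q))) => [a|_ w [q' qq' ->] wu Hw].
    by rewrite inE => /eqP->.
  apply: (@exI _ _ q'); apply: meetI; first exact: tvI.
  by apply: Hw; rewrite inE.
- apply: satI => u Hu z; apply=> //; first exact: fle_refl.
  move=> a; rewrite inE => /eqP->; apply: vD qq' _.
  by apply: Hu; rewrite inE.
- apply: satI => u Hu z Hz; have /vR/exE : u |-- v q by apply: Hu; rewrite inE.
  apply=> q' w wu /fle_meetP[/tvE qq' wq']; apply: qq' => qq'.
  by apply: (Hz [:: q'] w) => // [|a]; [exists q' | rewrite inE => /eqP->].
Qed.

Lemma upper_satP : (forall l D, upper_axiom l D -> satisfies v l D) <-> is_upper.
Proof.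
split=> [sat|[vD vR] _ _ [q q' qq'|q]].
- split=> [q q' u qq' uq'|q u uq].
    apply: (satE (sat _ _ (upper_up qq'))) => [a|_ w -> _ Hw].
      by rewrite inE => /eqP->.
    by apply: Hw; rewrite inE.
  apply: (satE (sat _ _ (upper_round q))) => [a|_ w [q' qq' ->] wu Hw].
    by rewrite inE => /eqP->.
  apply: (@exI _ _ q'); apply: meetI; first exact: tvI.
  by apply: Hw; rewrite inE.
- apply: satI => u Hu z; apply=> //; first exact: fle_refl.
  move=> a; rewrite inE => /eqP->; apply: vD qq' _.
  by apply: Hu; rewrite inE.
- apply: satI => u Hu z Hz; have /vR/exE : u |-- v q by apply: Hu; rewrite inE.
  apply=> q' w wu /fle_meetP[/tvE qq' wq']; apply: qq' => qq'.
  by apply: (Hz [:: q'] w) => // [|a]; [exists q' | rewrite inE => /eqP->].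
Qed.

End Lower.

Section Cut.
Variables (X : space) (v : rat + rat -> X).

Record is_cut : Prop := IsCut {
  cutL : is_lower (fun q => v (inl q));
  cutR : is_upper (fun r => v (inr r));
  cut_inhL : forall u, u |-- \ex q, v (inl q);
  cut_inhR : forall u, u |-- \ex r, v (inr r);
  cut_disj : forall q r u, u |-- v (inl q) -> u |-- v (inr r) -> u |-- \tv (q < r);
  cut_loc : forall q r u, q < r -> u |-- v (inl q) :|: v (inr r)
}.

Lemma real_satP : (forall l D, real_axiom l D -> satisfies v l D) <-> is_cut.
Proof.
split=> [sat|[vL vR iL iR di lo]]; last first.
  move=> _ _ [||l D ax|l D ax|q r|q r qr]; apply: satI => u Hu z Hz.
  - apply: exE (iL u) _ => q w wu wq; apply: (Hz [:: inl q] w) => //; first by exists q.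
    by move=> a; rewrite inE => /eqP->.
  - apply: exE (iR u) _ => q w wu wq; apply: (Hz [:: inr q] w) => //; first by exists q.
    by move=> a; rewrite inE => /eqP->.
  - apply: (satE ((lower_satP _).2 vL _ _ ax)) => [a al|d w Dd wu wd].
      exact: Hu (map_f inl al).
    by apply: (Hz (map inl d) w) => // [|_ /mapP[a ad ->]]; [exists d | exact: wd].
  - apply: (satE ((upper_satP _).2 vR _ _ ax)) => [a al|d w Dd wu wd].
      exact: Hu (map_f inr al).
    by apply: (Hz (map inr d) w) => // [|_ /mapP[a ad ->]]; [exists d | exact: wd].
  - have uq : u |-- v (inl q) by apply: Hu; rewrite inE eqxx.
    have ur : u |-- v (inr r) by apply: Hu; rewrite !inE eqxx orbT.
    by apply: tvE (di _ _ _ uq ur) _ => qr; apply: (Hz [::]) => //; exact: fle_refl.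
  - apply: joinE (lo q r u qr) _ _ => w wu wa.
      by apply: (Hz [:: inl q] w) => // [|a]; [left | rewrite inE => /eqP->].
    by apply: (Hz [:: inr r] w) => // [|a]; [right | rewrite inE => /eqP->].
split.
- apply/lower_satP => l D ax; apply: satI => u Hu z Hz.
  apply: (satE (sat _ _ (real_lower ax))) => [_ /mapP[a al ->]|]; first exact: Hu.
  move=> _ w [d Dd ->] wu Hd; apply: (Hz d w) => // a ad; exact: Hd (map_f inl ad).
- apply/upper_satP => l D ax; apply: satI => u Hu z Hz.
  apply: (satE (sat _ _ (real_upper ax))) => [_ /mapP[a al ->]|]; first exact: Hu.
  move=> _ w [d Dd ->] wu Hd; apply: (Hz d w) => // a ad; exact: Hd (map_f inr ad).
- move=> u; apply: (satE (sat _ _ real_inhL)) => // _ w [q ->] wu Hd.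
  by apply: (@exI _ _ q); apply: Hd; rewrite inE.
- move=> u; apply: (satE (sat _ _ real_inhR)) => // _ w [q ->] wu Hd.
  by apply: (@exI _ _ q); apply: Hd; rewrite inE.
- move=> q r u uq ur; apply: (satE (sat _ _ (real_disj q r))) => [a|].
    by rewrite !inE => /orP[]/eqP->.
  by move=> _ w [qr _] _ _; exact: tvI.
- move=> q r u qr; apply: (satE (sat _ _ (real_loc qr))) => // d w.
  case=> -> wu Hd; [apply: joinIl | apply: joinIr]; by apply: Hd; rewrite inE.
Qed.

End Cut.

Section SubSpaces.
Variable X : space.

Lemma sub_sat T E (p : pt X (@subT T E)) l D :
  @axiom T l D -> @satisfies X (atom T) p l D.
Proof. by move=> ax; exact: (pt_sat p (or_introl ax)). Qed.

Definition sub_pt T E (p : pt X (@subT T E)) : pt X T := Pt (sub_sat p).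

Lemma pt_is_lower (p : pt X LowerR) : is_lower p.
Proof. apply/lower_satP; exact: (pt_sat p). Qed.

Lemma pt_is_upper (p : pt X UpperR) : is_upper p.
Proof. apply/upper_satP; exact: (pt_sat p). Qed.

Lemma pt_is_cut (p : pt X RealT) : is_cut p.
Proof. apply/real_satP; exact: (pt_sat p). Qed.

Definition mk_real (v : rat + rat -> X) (vc : is_cut v) : pt X RealT :=
  @Pt X RealT v ((real_satP v).2 vc).

Lemma lowerNN_sat (v : rat -> X) : is_lower v ->
  (forall q u, q < 0 -> u |-- v q) ->
  forall l D, @axiom LowerNN l D -> satisfies v l D.
Proof.
move=> vL neg l D [/((lower_satP v).2 vL)//|[q q0]]; apply: satI => u Hu z Hz.
apply: (Hz [:: q] u) => //; first exact: fle_refl.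
by move=> a; rewrite inE => /eqP->; exact: neg.
Qed.

Lemma upperNN_sat (v : rat -> X) : is_upper v ->
  (forall r u, u |-- v r -> u |-- \tv (0 < r)) ->
  forall l D, @axiom UpperNN l D -> satisfies v l D.
Proof.
move=> vL pos l D [/((upper_satP v).2 vL)//|[r]]; apply: satI => u Hu z Hz.
have /pos/tvE : u |-- v r by apply: Hu; rewrite inE.
by apply=> r0; apply: (Hz [::] u) => //; exact: fle_refl.
Qed.

Lemma gt_sat (q : rat) (v : rat + rat -> X) : is_cut v ->
  (forall u, u |-- v (inl q)) ->
  forall l D, @axiom (@subT RealT (greater_than q)) l D -> satisfies v l D.
Proof.
move=> vc vq l D [/((real_satP v).2 vc)//|[]]; apply: satI => u Hu z Hz.
apply: (Hz [:: inl q] u) => //; first exact: fle_refl.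
by move=> a; rewrite inE => /eqP->; exact: vq.
Qed.

Definition mk_lowerNN (v : rat -> X) vL neg : pt X LowerNN :=
  @Pt X LowerNN v (lowerNN_sat vL neg).

Definition mk_upperNN (v : rat -> X) vU pos : pt X UpperNN :=
  @Pt X UpperNN v (upperNN_sat vU pos).

Definition mk_pos (v : rat + rat -> X) vc v0 : pt X PosReal :=
  @Pt X PosReal v (gt_sat vc v0).

Lemma gt_pt (q : rat) (p : pt X (@subT RealT (greater_than q))) u : u |-- p (inl q).
Proof.
apply: (satE (pt_sat p (or_intror (GreaterThan q)))) => // _ w -> _; apply.
by rewrite inE.
Qed.

Lemma gt_cut (q : rat) (p : pt X (@subT RealT (greater_than q))) : is_cut p.
Proof. exact: (pt_is_cut (sub_pt p)). Qed.

Lemma lowerNN_neg (p : pt X LowerNN) q u : q < 0 -> u |-- p q.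
Proof.
move=> q0; apply: (satE (pt_sat p (or_intror (ContainsNegative q0)))) => //.
by move=> _ w -> _; apply; rewrite inE.
Qed.

Lemma upperNN_pos (p : pt X UpperNN) r u : u |-- p r -> u |-- \tv (0 < r).
Proof.
move=> ur; apply: (satE (pt_sat p (or_intror (AllPositive r)))) => [a|].
  by rewrite inE => /eqP->.
by move=> _ w [r0 _] _ _; exact: tvI.
Qed.

Definition gt1_pos (p : pt X GtOneReal) : pt X PosReal :=
  mk_pos (gt_cut p)
    (fun u => lowerD (cutL (gt_cut p)) (ltr01 : (0 : rat) < 1) (gt_pt p u)).

End SubSpaces.

Section Rationals.
Implicit Types (c d q s t M : rat) (n : nat).

Lemma pow_ge1 d n : 1 < d -> 1 <= d ^+ n.
Proof. by move=> d1; apply: exprn_ege1; exact: ltW. Qed.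

Lemma pow_near1 c n : 1 < c -> exists2 d, 1 < d & d ^+ n < c.
Proof.
move=> c1; have [e e0 ec] : exists2 e, 0 < e <= 1 & 1 + 2 ^+ n * e < c.
  have K0 : (0 : rat) < 2 ^+ n by apply: exprn_gt0.
  pose e := Num.min 1 ((c - 1) / 2 ^+ n / 2).
  have c10 : 0 < (c - 1) / 2 ^+ n by apply: divr_gt0; lra.
  exists e; first by rewrite /e lt_min ge_min lexx andbT ltr01 /=; lra.
  have : e <= (c - 1) / 2 ^+ n / 2 by rewrite /e ge_min lexx orbT.
  rewrite -(ler_pM2l K0) => H; suff : 2 ^+ n * e < c - 1 by lra.
  apply: (le_lt_trans H); rewrite mulrA mulrCA divff ?mulr1; first lra.
  exact: lt0r_neq0.
exists (1 + e); first by case/andP: e0; lra.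
apply: le_lt_trans ec; case/andP: e0 => e0 e1.
apply: (@le_trans _ _ (1 + (2 ^+ n - 1) * e)); last lra.
elim: n => [|n IH]; first by rewrite !expr0; lra.
rewrite !exprS; have K1 : (1 : rat) <= 2 ^+ n by apply: exprn_ege1.
have e1' : 0 <= 1 + e by lra.
apply: le_trans (ler_wpM2l e1' IH) _.
have : 0 <= (2 ^+ n - 1) * (e * (1 - e)).
  by rewrite mulr_ge0 ?subr_ge0 // mulr_ge0 ?subr_ge0 // ltW.
by move: (2 ^+ n : rat) => K; lra.
Qed.

Lemma pow_unbounded c M : 1 < c -> exists n, M < c ^+ n.
Proof.
move=> c1; have [M0|M0] := ltP M 1; first by exists 0%N.
have e0 : 0 < c - 1 by lra.
have B n : 1 + n%:R * (c - 1) <= c ^+ n.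
  elim: n => [|n IH]; first by rewrite mul0r addr0.
  rewrite exprS -natr1; have k0 : (0 : rat) <= n%:R by [].
  apply: le_trans (ler_wpM2l _ IH); last lra.
  have : 0 <= n%:R * (c - 1) ^+ 2 by rewrite mulr_ge0 // sqr_ge0.
  by move: (n%:R : rat) => k; rewrite expr2; lra.
have H0 : 0 <= M / (c - 1) by apply: divr_ge0; lra.
exists (Num.bound (M / (c - 1))); apply: lt_le_trans (B _).
have := archi_boundP H0; rewrite ltr_pdivrMr // => ?; lra.
Qed.

Lemma root_between n q q' : (0 < n)%N -> q < q' -> 0 < q' ->
  exists2 s, 0 < s & q < s ^+ n < q'.
Proof.
move=> n0; wlog q0 : q / 0 < q => [H qq' q'0|qq' q'0].
  have [|||s s0 /andP[qs sq']] := H (Num.max q (q' / 2)) => //.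
  - by rewrite lt_max; apply/orP; right; lra.
  - by rewrite gt_max qq'; lra.
  exists s => //; rewrite sq' andbT; apply: le_lt_trans qs.
  by rewrite le_max lexx.
have c1 : 1 < q' / q by rewrite ltr_pdivlMr // mul1r.
have [d d1 dc] := pow_near1 n c1.
have d0 : 0 < d by lra.
have {}dc : d ^+ n * q < q' by rewrite -ltr_pdivlMr.
pose s0 := Num.min q 1.
have s00 : 0 < s0 by rewrite lt_min q0 ltr01.
have s01 : s0 <= 1 by rewrite ge_min lexx orbT.
have s0q : s0 <= q by rewrite ge_min lexx.
have ex : exists k, q < (s0 * d ^+ k) ^+ n.
  have [k Hk] := pow_unbounded ((q + 1) / s0) d1; exists k.
  move: Hk; rewrite ltr_pdivrMr // mulrC => Hk.
  apply: (@lt_le_trans _ _ (q + 1)); first lra.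
  apply: (le_trans (ltW Hk)); rewrite -[X in X <= _]expr1.
  apply: ler_weXn2l => //; lra.
case: (ex_minnP ex) => -[|k] Hk Hmin.
  have : s0 ^+ n <= q.
    apply: le_trans s0q; rewrite -[X in _ <= X]expr1.
    by apply: ler_wiXn2l => //; exact: ltW.
  by move: Hk; rewrite expr0 mulr1; lra.
exists (s0 * d ^+ k.+1); first by apply: mulr_gt0 => //; exact: exprn_gt0.
rewrite Hk /=; apply: le_lt_trans dc.
rewrite exprS mulrCA exprMn ler_pM2l ?exprn_gt0 //.
by case: (leP ((s0 * d ^+ k) ^+ n) q) => // /Hmin; rewrite ltnn.
Qed.

Lemma pow_lt_inv n s t : 0 <= t -> s ^+ n < t ^+ n -> s < t.
Proof.
move=> t0 H; rewrite ltNge; apply/negP => ts; move: H; rewrite ltNge => /negP.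
by apply; apply: lerXn2r => //; rewrite nnegrE // (le_trans t0 ts).
Qed.

Lemma pow_lt n s t : (0 < n)%N -> 0 <= s -> s < t -> s ^+ n < t ^+ n.
Proof. by move=> n0 s0 st; rewrite ltrXn2r // -lt0n. Qed.

End Rationals.

Section PositiveReals.
Variable X : space.
Implicit Types (x y z : pt X PosReal) (q r s t : rat) (u w : X).

Lemma posLle x q q' u : q <= q' -> u |-- x (inl q') -> u |-- x (inl q).
Proof.
by rewrite le_eqVlt => /orP[/eqP->//|]; exact: (lowerD (cutL (gt_cut x))).
Qed.

Lemma posRle x r r' u : r' <= r -> u |-- x (inr r') -> u |-- x (inr r).
Proof.
by rewrite le_eqVlt => /orP[/eqP->//|]; exact: (upperD (cutR (gt_cut x))).
Qed.

Lemma posLE x q u c : u |-- x (inl q) ->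
  (forall q' w, q < q' -> w |-- u -> w |-- x (inl q') -> w |-- c) -> u |-- c.
Proof.
move=> /(lowerR (cutL (gt_cut x)))/exE H Hc; apply: H => q' w wu.
by case/fle_meetP=> /tvE h wq; apply: h => qq'; exact: Hc qq' wu wq.
Qed.

Lemma posRE x r u c : u |-- x (inr r) ->
  (forall r' w, r' < r -> w |-- u -> w |-- x (inr r') -> w |-- c) -> u |-- c.
Proof.
move=> /(upperR (cutR (gt_cut x)))/exE H Hc; apply: H => q' w wu.
by case/fle_meetP=> /tvE h wq; apply: h => qq'; exact: Hc qq' wu wq.
Qed.

Lemma pos_inhL x u c :
  (forall s w, 0 < s -> w |-- u -> w |-- x (inl s) -> w |-- c) -> u |-- c.
Proof. by apply: posLE; exact: gt_pt. Qed.

Lemma pos_inhR x u c :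
  (forall r w, w |-- u -> w |-- x (inr r) -> w |-- c) -> u |-- c.
Proof. by move=> H; apply: exE (cut_inhR (gt_cut x) u) H. Qed.

Lemma pos_disj x q r u c : u |-- x (inl q) -> u |-- x (inr r) ->
  (q < r -> u |-- c) -> u |-- c.
Proof. by move=> uq ur; apply: tvE (cut_disj (gt_cut x) uq ur). Qed.

Lemma posR_gt0 x r u c : u |-- x (inr r) -> (0 < r -> u |-- c) -> u |-- c.
Proof. by apply: pos_disj; exact: gt_pt. Qed.

Lemma pos_loc x q r u c : q < r ->
  (forall w, w |-- u -> w |-- x (inl q) -> w |-- c) ->
  (forall w, w |-- u -> w |-- x (inr r) -> w |-- c) -> u |-- c.
Proof. by move=> qr; apply: joinE (cut_loc (gt_cut x) u qr). Qed.

Lemma pos_eq x y :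
  (forall q u, u |-- x (inl q) -> u |-- y (inl q)) ->
  (forall r u, u |-- x (inr r) -> u |-- y (inr r)) -> x = y.
Proof.
move=> HL HR; apply: pt_ext => -[q|r]; apply: fle_anti.
- exact: HL (fle_refl _).
- apply: (posLE (fle_refl _)) => q' w qq' wu wq'.
  apply: (pos_loc (x := x) qq') => // w' w'w /HR wr; ctx w'w.
  by apply: pos_disj wq' wr _; rewrite ltxx.
- exact: HR (fle_refl _).
- apply: (posRE (fle_refl _)) => r' w qq' wu wr'.
  apply: (pos_loc (x := x) qq') => // w' w'w /HL wq; ctx w'w.
  by apply: pos_disj wq wr' _; rewrite ltxx.
Qed.

Definition one_val (a : rat + rat) : X :=
  match a with inl q => \tv (q < 1) | inr r => \tv (1 < r) end.

Lemma one_cut : is_cut one_val.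
Proof.
split=> /=.
- split=> [q q' u qq' /tvE h|q u /tvE h]; apply: h => h.
    by apply: tvI; exact: lt_trans h.
  by apply: (@exI _ _ ((q + 1) / 2)); apply: meetI; apply: tvI; lra.
- split=> [q q' u qq' /tvE h|q u /tvE h]; apply: h => h.
    by apply: tvI; exact: lt_trans qq'.
  by apply: (@exI _ _ ((q + 1) / 2)); apply: meetI; apply: tvI; lra.
- by move=> u; apply: (@exI _ _ 0); exact: tvI.
- by move=> u; apply: (@exI _ _ 2); exact: tvI.
- by move=> q r u /tvE h1 /tvE h2; apply: h1 => h1; apply: h2 => h2; apply: tvI; lra.
- move=> q r u qr; have [q1|q1] := ltP q 1; first by apply: joinIl; exact: tvI.
  by apply: joinIr; apply: tvI; lra.
Qed.

Definition pone : pt X PosReal :=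
  mk_pos one_cut (fun u => tvI u (ltr01 : (0 : rat) < 1)).

Definition mul_val x y (a : rat + rat) : X :=
  match a with
  | inl q => \ex s, \ex t,
      \tv [/\ 0 < s, 0 < t & q < s * t] :&: (x (inl s) :&: y (inl t))
  | inr r => \ex s, \ex t,
      \tv (s * t < r) :&: (x (inr s) :&: y (inr t))
  end.

Lemma mulLI x y s t q u : 0 < s -> 0 < t -> q < s * t ->
  u |-- x (inl s) -> u |-- y (inl t) -> u |-- mul_val x y (inl q).
Proof.
move=> s0 t0 qst us ut; apply: (@exI _ _ s); apply: (@exI _ _ t).
by apply: meetI; [exact: tvI | exact: meetI].
Qed.

Lemma mulLE x y q u c : u |-- mul_val x y (inl q) ->
  (forall s t w, 0 < s -> 0 < t -> q < s * t -> w |-- u ->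
    w |-- x (inl s) -> w |-- y (inl t) -> w |-- c) -> u |-- c.
Proof.
move=> /exE H Hc; apply: H => s w wu /exE H; apply: H => t w' w'w.
case/fle_meetP=> /tvE H /fle_meetP[w's w't]; apply: H => -[s0 t0 st].
exact: (Hc s t w' s0 t0 st (fle_trans w'w wu)).
Qed.

Lemma mulRI x y s t r u : s * t < r ->
  u |-- x (inr s) -> u |-- y (inr t) -> u |-- mul_val x y (inr r).
Proof.
move=> qst us ut; apply: (@exI _ _ s); apply: (@exI _ _ t).
by apply: meetI; [exact: tvI | exact: meetI].
Qed.

Lemma mulRE x y r u c : u |-- mul_val x y (inr r) ->
  (forall s t w, 0 < s -> 0 < t -> s * t < r -> w |-- u ->
    w |-- x (inr s) -> w |-- y (inr t) -> w |-- c) -> u |-- c.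
Proof.
move=> /exE H Hc; apply: H => s w wu /exE H; apply: H => t w' w'w.
case/fle_meetP=> /tvE H /fle_meetP[w's w't]; apply: H => st.
apply: (posR_gt0 w's) => s0; apply: (posR_gt0 w't) => t0.
exact: (Hc s t w' s0 t0 st (fle_trans w'w wu)).
Qed.

Lemma pos_mloc x d u c : 1 < d ->
  (forall s w, 0 < s -> w |-- u -> w |-- x (inl s) -> w |-- x (inr (d * d * s)) ->
    w |-- c) -> u |-- c.
Proof.
move=> d1 Hc; have d0 : 0 < d by lra.
suff claim n : forall s w, 0 < s -> w |-- u -> w |-- x (inl s) ->
    w |-- x (inr (s * d ^+ n)) -> w |-- c.
  apply: (pos_inhL (x := x)) => s w s0 wu ws.
  apply: (pos_inhR (x := x)) => r w' w'w w'r.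
  have [n Hn] := pow_unbounded (r / s) d1.
  apply: (claim n s w' s0 (fle_trans w'w wu) (fle_trans w'w ws)).
  by apply: posRle w'r; rewrite mulrC -ler_pdivrMr // ltW.
elim: n => [|n IH] s w s0 wu ws wr.
  by apply: pos_disj ws wr _; rewrite expr0 mulr1 ltxx.
have sd : s * d < d * d * s.
  have -> : d * d * s = d * (s * d) by ring.
  by rewrite ltr_pMl // mulr_gt0.
apply: (pos_loc (x := x) sd) => w' w'w w'q.
  apply: (IH (s * d)) => //; first exact: mulr_gt0.
    exact: fle_trans w'w wu.
  by rewrite -mulrA -exprS; exact: fle_trans w'w wr.
exact: (Hc s w' s0 (fle_trans w'w wu) (fle_trans w'w ws) w'q).
Qed.

Lemma mul_cut x y : is_cut (mul_val x y).
Proof.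
split.
- split=> [q q' u qq' /mulLE|q u /mulLE]; apply=> s t w s0 t0 st wu ws wt.
    by apply: mulLI ws wt => //; exact: lt_trans st.
  apply: (@exI _ _ ((q + s * t) / 2)); apply: meetI; first by apply: tvI; lra.
  by apply: mulLI ws wt => //; lra.
- split=> [q q' u qq' /mulRE|q u /mulRE]; apply=> s t w s0 t0 st wu ws wt.
    by apply: mulRI ws wt => //; exact: lt_trans qq'.
  apply: (@exI _ _ ((q + s * t) / 2)); apply: meetI; first by apply: tvI; lra.
  by apply: mulRI ws wt => //; lra.
- move=> u; apply: (@exI _ _ 0).
  apply: (pos_inhL (x := x)) => s w s0 wu ws.
  apply: (pos_inhL (x := y)) => t w' t0 w'w w't; ctx w'w.
  by apply: mulLI ws w't => //; exact: mulr_gt0.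
- move=> u; apply: (pos_inhR (x := x)) => s w wu ws.
  apply: (pos_inhR (x := y)) => t w' w'w w't; ctx w'w.
  by apply: (@exI _ _ (s * t + 1)); apply: mulRI ws w't => //; lra.
- move=> q r u /mulLE HL HR; apply: HL => s t w s0 t0 st wu ws wt; ctx wu.
  apply: (mulRE HR) => s' t' w' s'0 t'0 st' w'w ws' wt'; ctx w'w.
  apply: (pos_disj ws ws') => ss'; apply: (pos_disj wt wt') => tt'.
  by apply: tvI; nra.
- move=> q r u qr; have [q0|q0] := ltP q 0.
    apply: joinIl; apply: (pos_inhL (x := x)) => s w s0 wu ws.
    apply: (pos_inhL (x := y)) => t w' t0 w'w w't; ctx w'w.
    by apply: mulLI ws w't => //; nra.
  have [q' qq' q'r] : exists2 q', q < q' & q' < r by exists ((q + r) / 2); lra.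
  have q'0 : 0 < q' by lra.
  have c1 : 1 < r / q' by rewrite ltr_pdivlMr // mul1r.
  have [d d1 dc] := pow_near1 4 c1; have {}dc : d ^+ 4 * q' < r.
    by rewrite -ltr_pdivlMr.
  apply: (pos_mloc (x := x) d1) => s w s0 wu ws wds.
  apply: (pos_mloc (x := y) d1) => t w' t0 w'w wt wdt; ctx w'w.
  have [qst|qst] := ltP q (s * t); first by apply: joinIl; exact: mulLI ws wt.
  apply: joinIr; apply: mulRI wds wdt; apply: le_lt_trans dc.
  have -> : d * d * s * (d * d * t) = d ^+ 4 * (s * t) by ring.
  by rewrite ler_pM2l ?exprn_gt0 //; lra.
Qed.

Lemma mul_gt0 x y u : u |-- mul_val x y (inl 0).
Proof.
apply: (pos_inhL (x := x)) => s w s0 wu ws.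
apply: (pos_inhL (x := y)) => t w' t0 w'w w't; ctx w'w.
by apply: mulLI ws w't => //; exact: mulr_gt0.
Qed.

Definition mul x y : pt X PosReal := mk_pos (mul_cut x y) (mul_gt0 x y).

Definition inv_val x (a : rat + rat) : X :=
  match a with
  | inl q => \ex t, \tv (q < t^-1) :&: x (inr t)
  | inr r => \ex s, \tv (0 < s /\ s^-1 < r) :&: x (inl s)
  end.

Lemma invLI x t q u : q < t^-1 -> u |-- x (inr t) -> u |-- inv_val x (inl q).
Proof. by move=> qt ut; apply: (@exI _ _ t); apply: meetI => //; exact: tvI. Qed.

Lemma invLE x q u c : u |-- inv_val x (inl q) ->
  (forall t w, 0 < t -> q < t^-1 -> w |-- u -> w |-- x (inr t) -> w |-- c) ->
  u |-- c.
Proof.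
move=> /exE H Hc; apply: H => t w wu /fle_meetP[/tvE H wt]; apply: H => qt.
by apply: (posR_gt0 wt) => t0; exact: Hc t0 qt wu wt.
Qed.

Lemma invRI x s r u : 0 < s -> s^-1 < r -> u |-- x (inl s) ->
  u |-- inv_val x (inr r).
Proof. by move=> s0 qt ut; apply: (@exI _ _ s); apply: meetI => //; exact: tvI. Qed.

Lemma invRE x r u c : u |-- inv_val x (inr r) ->
  (forall s w, 0 < s -> s^-1 < r -> w |-- u -> w |-- x (inl s) -> w |-- c) ->
  u |-- c.
Proof.
move=> /exE H Hc; apply: H => t w wu /fle_meetP[/tvE H wt]; apply: H => -[s0 qt].
exact: Hc s0 qt wu wt.
Qed.

Lemma inv_cut x : is_cut (inv_val x).
Proof.
split.
- split=> [q q' u qq' /invLE|q u /invLE]; apply=> t w t0 qt wu wt.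
    by apply: invLI wt; exact: lt_trans qt.
  apply: (@exI _ _ ((q + t^-1) / 2)); apply: meetI; first by apply: tvI; lra.
  by apply: invLI wt; lra.
- split=> [q q' u qq' /invRE|q u /invRE]; apply=> t w t0 qt wu wt.
    by apply: invRI wt => //; exact: lt_trans qq'.
  apply: (@exI _ _ ((q + t^-1) / 2)); apply: meetI; first by apply: tvI; lra.
  by apply: invRI wt => //; lra.
- move=> u; apply: (pos_inhR (x := x)) => t w wu wt.
  by apply: (@exI _ _ (t^-1 - 1)); apply: invLI wt; lra.
- move=> u; apply: (pos_inhL (x := x)) => t w t0 wu wt.
  by apply: (@exI _ _ (t^-1 + 1)); apply: invRI wt => //; lra.
- move=> q r u /invLE HL HR; apply: HL => t w t0 qt wu wt; ctx wu.
  apply: (invRE HR) => s w' s0 sr w'w ws; ctx w'w.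
  apply: (pos_disj ws wt) => st; apply: tvI.
  by have : t^-1 < s^-1 by [rewrite ltf_pV2]; lra.
- move=> q r u qr; have [q0|q0] := leP q 0.
    apply: joinIl; apply: (pos_inhR (x := x)) => t w wu wt.
    apply: (posR_gt0 wt) => t0; apply: invLI wt.
    by apply: le_lt_trans q0 _; rewrite invr_gt0.
  have [q1 q11 q12] : exists2 q', q < q' & q' < r by exists ((q + r) / 2); lra.
  have [q2 q21 q22] : exists2 q', q1 < q' & q' < r by exists ((q1 + r) / 2); lra.
  have q10 : 0 < q1 by lra.
  have q20 : 0 < q2 by lra.
  have q21V : q2^-1 < q1^-1 by rewrite ltf_pV2.
  apply: (pos_loc (x := x) q21V) => w wu wq.
    by apply: joinIr; apply: invRI wq; rewrite ?invr_gt0 ?invrK.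
  by apply: joinIl; apply: invLI wq; rewrite invrK.
Qed.

Lemma inv_gt0 x u : u |-- inv_val x (inl 0).
Proof.
apply: (pos_inhR (x := x)) => t w wu wt; apply: (posR_gt0 wt) => t0.
by apply: invLI wt; rewrite invr_gt0.
Qed.

Definition inv x : pt X PosReal := mk_pos (inv_cut x) (inv_gt0 x).

Definition pow x (n : nat) : pt X PosReal := iter n (mul x) pone.

Lemma mulC x y : mul x y = mul y x.
Proof.
apply: pos_eq => q u; [move/mulLE | move/mulRE]; apply=> s t w s0 t0 st wu ws wt.
  by apply: mulLI wt ws; rewrite // mulrC.
by apply: mulRI wt ws; rewrite mulrC.
Qed.

Lemma mul1 x : mul pone x = x.
Proof.
apply: pos_eq => q u.
  move/mulLE; apply=> s t w s0 t0 st wu /tvE ws wt; apply: ws => s1.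
  by apply: posLle wt; nra.
move/mulRE; apply=> s t w s0 t0 st wu /tvE ws wt; apply: ws => s1.
by apply: posRle wt; nra.
Qed.

Lemma mulA x y z : mul x (mul y z) = mul (mul x y) z.
Proof.
apply: pos_eq => q u.
  move/mulLE; apply=> s t w s0 t0 st wu ws /mulLE; apply.
  move=> t1 t2 w' t10 t20 t12 w'w wt1 wt2; ctx w'w.
  have [p tp pt] : exists2 p, t < p & p < t1 * t2.
    by exists ((t + t1 * t2) / 2); lra.
  have p0 : 0 < p by lra.
  have pt2 : s * p / t2 < s * t1.
    by rewrite ltr_pdivrMr // -mulrA ltr_pM2l.
  have sp0 : 0 < s * p / t2 by rewrite divr_gt0 ?mulr_gt0.
  apply: (@mulLI _ _ (s * p / t2) t2) => //; last exact: mulLI ws wt1.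
  by rewrite divfK ?lt0r_neq0 //; apply: lt_trans st _; rewrite ltr_pM2l.
move/mulRE; apply=> s t w s0 t0 st wu ws /mulRE; apply.
move=> t1 t2 w' t10 t20 t12 w'w wt1 wt2; ctx w'w.
have pt2 : s * t1 < s * t / t2.
  by rewrite ltr_pdivlMr // -mulrA ltr_pM2l.
apply: (@mulRI _ _ (s * t / t2) t2) => //; last exact: mulRI ws wt1.
by rewrite divfK ?lt0r_neq0.
Qed.

Lemma mulV x : mul (inv x) x = pone.
Proof.
apply: pos_eq => q u.
  move/mulLE; apply=> s t w s0 t0 st wu /invLE ws wt; apply: ws.
  move=> s' w' s'0 ss w'w ws; ctx w'w; apply: (pos_disj wt ws) => ts.
  apply: tvI; apply: lt_trans st _; rewrite -ltr_pdivlMr // mul1r.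
  by apply: lt_trans ss _; rewrite ltf_pV2.
move/mulRE; apply=> s t w s0 t0 st wu /invRE ws wt; apply: ws.
move=> s' w' s'0 ss w'w ws; ctx w'w; apply: (pos_disj ws wt) => ts.
apply: tvI; apply: lt_trans st; rewrite -ltr_pdivrMr // mul1r.
by apply: lt_trans ss; rewrite ltf_pV2.
Qed.

Lemma mul_cancel z x y : mul z x = mul z y -> x = y.
Proof. by move/(congr1 (mul (inv z))); rewrite !mulA mulV !mul1. Qed.

Lemma mulACA x y z z' : mul (mul x y) (mul z z') = mul (mul x z) (mul y z').
Proof. by rewrite -mulA [mul y _]mulA [mul y z]mulC -[mul (mul z y) _]mulA mulA. Qed.

Lemma pow1 x : pow x 1 = x.
Proof. by rewrite /= mulC mul1. Qed.

Lemma powS x n : pow x n.+1 = mul x (pow x n).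
Proof. by []. Qed.

Lemma powD x m n : pow x (m + n) = mul (pow x m) (pow x n).
Proof. by elim: m => [|m IH]; rewrite ?mul1 // addSn !powS IH mulA. Qed.

Lemma powMl x y n : pow (mul x y) n = mul (pow x n) (pow y n).
Proof. by elim: n => [|n IH]; rewrite ?mul1 // !powS IH mulACA. Qed.

Lemma pow_one n : pow pone n = pone.
Proof. by elim: n => [//|n IH]; rewrite powS IH mul1. Qed.

Lemma powM x m n : pow x (m * n) = pow (pow x m) n.
Proof.
elim: m => [|m IH]; first by rewrite mul0n /= pow_one.
by rewrite mulSn powD IH powS powMl.
Qed.

Lemma powLI x n s q u : 0 < s -> q < s ^+ n -> u |-- x (inl s) ->
  u |-- pow x n (inl q).
Proof.
elim: n q u => [|n IH] q u s0 qs us; first exact: tvI.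
have [p qp ps] : exists2 p, q < p & p < s ^+ n.+1.
  by exists ((q + s ^+ n.+1) / 2); lra.
have {}IH : u |-- pow x n (inl (Num.max (p / s) (s ^+ n / 2))).
  apply: IH => //; rewrite gt_max ltr_pdivrMr // -exprSr ps /=.
  by have : 0 < s ^+ n by [exact: exprn_gt0]; lra.
apply: mulLI us IH => //.
  rewrite lt_max; apply/orP; right.
  by have : 0 < s ^+ n by [exact: exprn_gt0]; lra.
apply: lt_le_trans qp _; rewrite mulrC -ler_pdivrMr // le_max lexx //.
Qed.

Lemma powLE x n q u c : u |-- pow x n (inl q) ->
  (forall s w, 0 < s -> q < s ^+ n -> w |-- u -> w |-- x (inl s) -> w |-- c) ->
  u |-- c.
Proof.
elim: n q u c => [|n IH] q u c uq Hc.
  apply: (pos_inhL (x := x)) => s w s0 wu ws.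
  by apply: tvE (fle_trans wu uq) _ => q1; exact: (Hc s).
apply: (mulLE uq) => s t w s0 t0 st wu ws wt.
apply: (IH _ _ _ wt) => s' w' s'0 ts' w'w ws'.
have n0 : 0 <= s' ^+ n by apply: exprn_ge0; exact: ltW.
apply: (Hc (Num.max s s')); first by rewrite lt_max s0.
- apply: lt_le_trans st _; apply: (@le_trans _ _ (s * s' ^+ n)).
    by rewrite ler_pM2l // ltW.
  rewrite exprS; apply: ler_pM => //; [exact: ltW | by rewrite le_max lexx |].
  apply: lerXn2r; rewrite ?nnegrE ?le_max ?lexx ?orbT //; first exact: ltW.
  by rewrite (ltW s'0) orbT.
- exact: fle_trans w'w wu.
- by have [ss|ss] := leP s s' => //; exact: fle_trans w'w ws.
Qed.

Lemma powRI x n s r u : s ^+ n < r -> u |-- x (inr s) -> u |-- pow x n (inr r).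
Proof.
elim: n r u => [|n IH] r u qs us; first exact: tvI.
apply: (posR_gt0 us) => s0.
have [p qp ps] : exists2 p, s ^+ n.+1 < p & p < r.
  by exists ((r + s ^+ n.+1) / 2); lra.
have {}IH : u |-- pow x n (inr (p / s)).
  by apply: IH => //; rewrite ltr_pdivlMr // -exprSr.
by apply: mulRI us IH; rewrite mulrC divfK ?lt0r_neq0.
Qed.

Lemma powRE x n r u c : u |-- pow x n (inr r) ->
  (forall s w, 0 < s -> s ^+ n < r -> w |-- u -> w |-- x (inr s) -> w |-- c) ->
  u |-- c.
Proof.
elim: n r u c => [|n IH] r u c ur Hc.
  apply: (pos_inhR (x := x)) => s w wu ws; apply: (posR_gt0 ws) => s0.
  by apply: tvE (fle_trans wu ur) _ => q1; exact: (Hc s).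
apply: (mulRE ur) => s t w s0 t0 st wu ws wt.
apply: (IH _ _ _ wt) => s' w' s'0 ts' w'w ws'.
apply: (Hc (Num.min s s')); first by rewrite lt_min s0.
- apply: le_lt_trans st; apply: (@le_trans _ _ (s * s' ^+ n)); last first.
    by rewrite ler_pM2l // ltW.
  have m0 : 0 <= Num.min s s' by rewrite le_min !ltW.
  rewrite exprS; apply: ler_pM; rewrite ?exprn_ge0 ?ge_min ?lexx //.
  by apply: lerXn2r; rewrite ?nnegrE ?ge_min ?lexx ?orbT // ltW.
- exact: fle_trans w'w wu.
- by have [ss|ss] := leP s s' => //; exact: fle_trans w'w ws.
Qed.

Definition root_val x n (a : rat + rat) : X :=
  match a with
  | inl q => \ex s, \tv (0 < s /\ q < s) :&: x (inl (s ^+ n))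
  | inr r => \ex s, \tv (0 < s /\ s < r) :&: x (inr (s ^+ n))
  end.

Lemma root_cut x n : (0 < n)%N -> is_cut (root_val x n).
Proof.
move=> n0; split => /=.
- split=> [q q' u qq' /exE|q u /exE]; apply=> s w wu /fle_meetP[/tvE H ws].
    apply: H => -[s0 qs]; apply: (@exI _ _ s); apply: meetI => //; apply: tvI.
    by split=> //; exact: lt_trans qs.
  apply: H => -[s0 qs]; apply: (@exI _ _ ((q + s) / 2)).
  apply: meetI; first by apply: tvI; lra.
  by apply: (@exI _ _ s); apply: meetI => //; apply: tvI; lra.
- split=> [q q' u qq' /exE|q u /exE]; apply=> s w wu /fle_meetP[/tvE H ws].
    apply: H => -[s0 qs]; apply: (@exI _ _ s); apply: meetI => //; apply: tvI.
    by split=> //; exact: lt_trans qq'.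
  apply: H => -[s0 qs]; apply: (@exI _ _ ((q + s) / 2)).
  apply: meetI; first by apply: tvI; lra.
  by apply: (@exI _ _ s); apply: meetI => //; apply: tvI; lra.
- move=> u; apply: (pos_inhL (x := x)) => t w t0 wu wt; apply: (@exI _ _ 0).
  have [s s0 /andP[_ st]] := root_between n0 t0 t0.
  by apply: (@exI _ _ s); apply: meetI; [exact: tvI | apply: posLle wt; exact: ltW].
- move=> u; apply: (pos_inhR (x := x)) => t w wu wt.
  apply: (posR_gt0 wt) => t0.
  have tt : t < t + 1 by lra.
  have t10 : 0 < t + 1 by lra.
  have [s s0 /andP[st _]] := root_between n0 tt t10; apply: (@exI _ _ (s + 1)).
  apply: (@exI _ _ s); apply: meetI; last by apply: posRle wt; exact: ltW.
  by apply: tvI; lra.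
- move=> q r u /exE HL HR; apply: HL => s w wu /fle_meetP[/tvE H ws]; apply: H => -[s0 qs].
  ctx wu; apply: exE HR _ => t w' w'w /fle_meetP[/tvE H wt]; apply: H => -[t0 tr].
  ctx w'w; apply: (pos_disj ws wt) => /(pow_lt_inv (ltW t0)) st; apply: tvI; lra.
- move=> q r u qr; have [r0|r0] := leP r 0.
    apply: joinIl; apply: (pos_inhL (x := x)) => t w t0 wu wt.
    have [s s0 /andP[_ st]] := root_between n0 t0 t0.
    apply: (@exI _ _ s); apply: meetI; last by apply: posLle wt; exact: ltW.
    by apply: tvI; lra.
  pose q0 := Num.max q (r / 2); have q0r : q0 < r by rewrite gt_max qr; lra.
  have q00 : 0 < q0 by rewrite lt_max; apply/orP; right; lra.
  have qq0 : q <= q0 by rewrite le_max lexx.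
  pose a := (2 * q0 + r) / 3; pose b := (q0 + 2 * r) / 3.
  have a0 : 0 < a by rewrite /a; lra.
  have b0 : 0 < b by rewrite /b; lra.
  have ab : a ^+ n < b ^+ n by apply: pow_lt => //; [exact: ltW | rewrite /a /b; lra].
  apply: (pos_loc (x := x) ab) => w wu ws.
    apply: joinIl; apply: (@exI _ _ a); apply: meetI => //; apply: tvI.
    by split=> //; rewrite /a; lra.
  apply: joinIr; apply: (@exI _ _ b); apply: meetI => //; apply: tvI.
  by split=> //; rewrite /b; lra.
Qed.

Lemma root_gt0 x n u : (0 < n)%N -> u |-- root_val x n (inl 0).
Proof.
move=> n0; apply: (pos_inhL (x := x)) => t w t0 wu wt.
have [s s0 /andP[_ st]] := root_between n0 t0 t0.
apply: (@exI _ _ s); apply: meetI; first exact: tvI.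
by apply: posLle wt; exact: ltW.
Qed.

Lemma pow_inj n y z : (0 < n)%N -> pow y n = pow z n -> y = z.
Proof.
move=> n0 yz; apply: pos_eq => q u.
  move=> uq; have {}uq : u |-- y (inl (Num.max q 0)).
    by rewrite maxEle; case: ifP => // _; exact: gt_pt.
  apply: (@posLle _ _ (Num.max q 0)); first by rewrite le_max lexx.
  have: 0 <= Num.max q 0 by rewrite le_max lexx orbT.
  move: (Num.max q 0) uq => {}q uq q0.
  apply: (posLE uq) => q' w qq' wu wq'; ctx wu.
  have /powLE : w |-- pow z n (inl (q ^+ n)).
    by rewrite -yz; apply: powLI wq'; [lra | exact: pow_lt].
  apply=> s w' s0 /(pow_lt_inv (ltW s0)) qs w'w; exact: posLle (ltW qs).
move=> ur; apply: (posRE ur) => r' w rr' wu wr'; ctx wu.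
apply: (posR_gt0 wr') => r'0; have r0 : 0 <= q by lra.
have /powRE : w |-- pow z n (inr (q ^+ n)).
  by rewrite -yz; apply: powRI wr'; apply: pow_lt => //; exact: ltW.
by apply=> s w' s0 /(pow_lt_inv r0) qs w'w; exact: posRle (ltW qs).
Qed.

Lemma root_exists x n : (0 < n)%N -> exists y, pow y n = x.
Proof.
move=> n0; exists (mk_pos (root_cut x n0) (fun u => root_gt0 x u n0)).
apply: pos_eq => q u.
  move/powLE; apply=> s w s0 qs wu /exE; apply=> t w' w'w.
  case/fle_meetP=> /tvE H wt; apply: H => -[t0 st]; apply: posLle wt.
  by apply: ltW; apply: lt_trans qs _; apply: pow_lt => //; exact: ltW.
move/powRE; apply=> s w s0 qs wu /exE; apply=> t w' w'w.
case/fle_meetP=> /tvE H wt; apply: H => -[t0 st]; apply: posRle wt.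
by apply: ltW; apply: lt_trans qs; apply: pow_lt => //; exact: ltW.
Qed.

(* The choice made by cid is irrelevant: see root_uniq. *)
Definition nth_root x n (n0 : (0 < n)%N) : pt X PosReal :=
  projT1 (cid (root_exists x n0)).

Lemma rootK x n (n0 : (0 < n)%N) : pow (nth_root x n0) n = x.
Proof. exact: projT2 (cid (root_exists x n0)). Qed.

Lemma root_uniq x y n (n0 : (0 < n)%N) : pow y n = x -> y = nth_root x n0.
Proof. by move=> yx; apply: (pow_inj n0); rewrite rootK. Qed.

Lemma absz_denq_gt0 q : (0 < `|denq q|)%N.
Proof. by rewrite absz_gt0 denq_neq0. Qed.

(* x ^ (m / n) = (x ^ m) ^ (1 / n) for m / n >= 0 in lowest terms and
   x ^ (- q) = (x ^ q)^-1; rpow_spec shows that fractions that are not in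
   lowest terms give the same power. *)
Definition rpow x q : pt X PosReal :=
  let r := nth_root (pow x `|numq q|%N) (absz_denq_gt0 q) in
  if q < 0 then inv r else r.

End PositiveReals.

Section RationalPowers.
Variable X : space.
Implicit Types (x y z : pt X PosReal) (q r s t e : rat) (u w : X).

Lemma num_denq q : q * (`|denq q|%N)%:R =
  if q < 0 then - (`|numq q|%N)%:R else (`|numq q|%N)%:R.
Proof.
have dE : (`|denq q|%N)%:R = (denq q)%:~R :> rat by rewrite -{2}[denq q]absz_denq.
have -> : q * (`|denq q|%N)%:R = (numq q)%:~R.
  by rewrite dE -{1}[q]divq_num_den divfK // intr_eq0 denq_neq0.
by rewrite -numq_lt0; case: (numq q) => n //=; rewrite NegzE rmorphN.
Qed.

Lemma pow_invK x n : mul (pow x n) (pow (inv x) n) = pone X.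
Proof. by rewrite -powMl [mul x _]mulC mulV pow_one. Qed.

Lemma rpow_spec x q N m1 m2 : q * N%:R = m1%:R - m2%:R ->
  mul (pow (rpow x q) N) (pow x m2) = pow x m1.
Proof.
move=> qN; rewrite /rpow; set p := `|numq q|%N; set d0 := absz_denq_gt0 q.
set d := `|denq q|%N in d0 *; have := num_denq q; rewrite -/p -/d => qd.
have dN0 : d%:R != 0 :> rat by rewrite pnatr_eq0 -lt0n.
case: ifP qd => _ qd.
  apply: (mul_cancel (z := pow (nth_root (pow x p) d0) N)).
  rewrite mulA pow_invK mul1; apply: (pow_inj d0).
  rewrite powMl -!powM [(N * d)%N]mulnC [pow _ (d * N)]powM rootK -powM -powD.
  congr pow; apply/eqP; rewrite -(eqr_nat rat) natrD !natrM.
  have -> : p%:R = - (q * d%:R) :> rat by rewrite qd opprK.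
  apply/eqP; have -> : m1%:R = q * N%:R + m2%:R :> rat by rewrite qN subrK.
  ring.
apply: (pow_inj d0).
rewrite powMl -!powM [(N * d)%N]mulnC [pow _ (d * N)]powM rootK -powM -powD.
congr pow; apply/eqP; rewrite -(eqr_nat rat) natrD !natrM -qd.
apply/eqP; have -> : m1%:R = q * N%:R + m2%:R :> rat by rewrite qN subrK.
ring.
Qed.

Lemma rat_frac q : exists N m1 m2, (0 < N)%N /\ q * N%:R = m1%:R - m2%:R :> rat.
Proof.
exists `|denq q|%N; case: (ltP q 0) (num_denq q) => _ qd.
  by exists 0%N, `|numq q|%N; split; [exact: absz_denq_gt0 | rewrite qd sub0r].
by exists `|numq q|%N, 0%N; split; [exact: absz_denq_gt0 | rewrite qd subr0].
Qed.

Lemma rpow_add x e e' : rpow x (e + e') = mul (rpow x e) (rpow x e').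
Proof.
have [N [m1 [m2 [N0 HN]]]] := rat_frac e.
have [M [k1 [k2 [M0 HM]]]] := rat_frac e'.
have eNM : e * (N * M)%:R = (m1 * M)%:R - (m2 * M)%:R by rewrite !natrM mulrA HN; ring.
have e'NM : e' * (N * M)%:R = (k1 * N)%:R - (k2 * N)%:R.
  by rewrite !natrM [N%:R * _]mulrC mulrA HM; ring.
have eeNM : (e + e') * (N * M)%:R = (m1 * M + k1 * N)%:R - (m2 * M + k2 * N)%:R.
  by rewrite mulrDl eNM e'NM !natrD; ring.
have NM0 : (0 < N * M)%N by rewrite muln_gt0 N0.
apply: (pow_inj NM0); apply: (mul_cancel (z := pow x (m2 * M + k2 * N))).
rewrite [LHS]mulC (rpow_spec _ eeNM) [RHS]mulC powMl !powD mulACA.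
by rewrite (rpow_spec _ eNM) (rpow_spec _ e'NM).
Qed.

Lemma rpow_nat x n : rpow x n%:R = pow x n.
Proof.
have H : n%:R * 1%:R = n%:R - 0%:R :> rat by rewrite mulr1 subr0.
by have := rpow_spec x H; rewrite pow1 mulC mul1.
Qed.

Lemma rpow0 x : rpow x 0 = pone X.
Proof. exact: (rpow_nat x 0). Qed.

Lemma mulr1L x y q u : u |-- y (inl 1) -> u |-- x (inl q) -> u |-- mul x y (inl q).
Proof.
move=> u1 uq; have {}uq : u |-- x (inl (Num.max q 0)).
  by rewrite maxEle; case: ifP => // _; exact: gt_pt.
apply: (posLE uq) => q' w; rewrite gt_max => /andP[qq' q'0] wu wq'; ctx wu.
by apply: mulLI wq' u1; rewrite ?mulr1 ?ltr01.
Qed.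

Lemma rpow_gt1 x e u : u |-- x (inl 1) -> 0 < e -> u |-- rpow x e (inl 1).
Proof.
move=> ux e0.
have n0 : (0 < `|numq e|)%N by rewrite absz_gt0 numq_eq0 gt_eqF.
have H : e * (`|denq e|%N)%:R = (`|numq e|%N)%:R - 0%:R.
  by rewrite num_denq ltNge ltW // subr0.
have /powLE : u |-- pow (rpow x e) `|denq e|%N (inl 1).
  have := rpow_spec x H; rewrite mulC mul1 => ->.
  apply: (posLE ux) => s w s1 wu ws; ctx wu.
  by apply: powLI ws; [lra | rewrite exprn_egt1 // -lt0n].
apply=> s w s0 s1 wu ws; apply: posLle ws; apply: ltW.
by apply: (@pow_lt_inv `|denq e|%N); [exact: ltW | rewrite expr1n].
Qed.

Lemma rpow_monoL x e e' q u : u |-- x (inl 1) -> e < e' ->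
  u |-- rpow x e (inl q) -> u |-- rpow x e' (inl q).
Proof.
move=> ux ee' uq; have -> : e' = e + (e' - e) by rewrite addrC subrK.
by rewrite rpow_add; apply: mulr1L uq; apply: rpow_gt1; rewrite ?subr_gt0.
Qed.

Lemma rpow_dense x q r u c : u |-- x (inl 1) -> 0 < q -> q < r ->
  (forall e w, w |-- u -> w |-- rpow x e (inl q) -> w |-- rpow x e (inr r) ->
    w |-- c) -> u |-- c.
Proof.
move=> ux q0 qr Hc; have c1 : 1 < r / q by rewrite ltr_pdivlMr // mul1r.
have [d d1 dc] := pow_near1 2 c1; have {}dc : d ^+ 2 * q < r by rewrite -ltr_pdivlMr.
have d0 : 0 < d by lra.
have dq : d * q < d ^+ 2 * q by rewrite ltr_pM2r // expr2 ltr_pMl.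
have qdq : q < d * q by rewrite ltr_pMl.
apply: (pos_inhR (x := x)) => M w wu wM.
have [N HN] := pow_unbounded M d1.
pose h : rat := N.+1%:R^-1; have h0 : 0 < h by rewrite invr_gt0 ltr0Sn.
have hd : w |-- rpow x h (inr d).
  have hN : h * N.+1%:R = 1%:R - 0%:R by rewrite mulVf ?pnatr_eq0 // subr0.
  have := rpow_spec x hN; rewrite mulC mul1 pow1 => hx.
  have /powRE : w |-- pow (rpow x h) N.+1 (inr M) by rewrite hx.
  apply=> s w' s0 sM w'w ws; apply: posRle ws; apply: ltW.
  apply: (@pow_lt_inv N.+1); first exact: ltW.
  apply: lt_trans sM _; apply: lt_trans HN _; rewrite exprS ltr_pMl //.
  exact: exprn_gt0.
apply: (posLE (fle_trans wu ux)) => m w' m1 w'w wm.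
have [K HK] := pow_unbounded (q + q^-1) m1.
have qV : 0 < q^-1 by rewrite invr_gt0.
have KL : w' |-- rpow x K%:R (inl (q + q^-1)).
  by rewrite rpow_nat; apply: powLI wm => //; lra.
have {wM wm m m1 HK HN} w'u := fle_trans w'w wu.
have {w'w hd} hd := fle_trans w'w hd.
suff claim n : forall e a, a |-- w' -> a |-- rpow x e (inr (d ^+ 2 * q)) ->
    a |-- rpow x (e + n%:R * h) (inl q) -> a |-- c.
  apply: (pos_loc (x := rpow x (- K%:R)) (lt_trans qdq dq)) => a aw' aq.
    have H : a |-- mul (rpow x (- K%:R)) (rpow x K%:R) (inl 1).
      apply: mulLI aq (fle_trans aw' KL) => //; first lra.
      have : 0 < q * q by exact: mulr_gt0.
      by rewrite mulrDr divff ?gt_eqF //; lra.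
    by rewrite -rpow_add addNr rpow0 in H; apply: tvE H _; rewrite ltxx.
  apply: (claim (2 * K * N.+1)%N (- K%:R) a aw' aq).
  have -> : - K%:R + (2 * K * N.+1)%:R * h = K%:R :> rat.
    rewrite natrM -mulrA divff ?pnatr_eq0 // natrM; ring.
  by apply: posLle (fle_trans aw' KL); lra.
elim: n => [|n IH] e a aw' ae1 ae2.
  apply: (Hc e _ (fle_trans aw' w'u)); first by rewrite mul0r addr0 in ae2.
  by apply: posRle ae1; exact: ltW.
apply: (pos_loc (x := rpow x (e + h)) dq) => b ba bq; last first.
  apply: (IH (e + h)) => //; first exact: fle_trans ba aw'.
  apply: fle_trans ba _; move: ae2; rewrite -natr1 mulrDl mul1r.
  by rewrite [n%:R * h + h]addrC addrA.
move: bq; rewrite rpow_add => /mulLE; apply=> s t b' s0 t0 st b'b bs bt.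
have bd := fle_trans b'b (fle_trans ba (fle_trans aw' hd)).
apply: (pos_disj bt bd) => td.
apply: (Hc e); first exact: fle_trans b'b (fle_trans ba (fle_trans aw' w'u)).
  apply: posLle bs; rewrite -(ler_pM2l d0); apply/ltW/(lt_trans st).
  by rewrite mulrC ltr_pM2r.
by apply: fle_trans b'b (fle_trans ba _); apply: posRle ae1; exact: ltW.
Qed.

End RationalPowers.

Section Exponentiation.
Variables (X : space) (b : pt X GtOneReal).
Implicit Types (q r s t e : rat) (u w : X).

Local Notation bp e := (rpow (gt1_pos b) e).

Definition expL_val (z : pt X LowerR) (q : rat) : X :=
  \tv (q < 0) :|: \ex e, z e :&: bp e (inl q).

Definition expR_val (z : pt X UpperR) (r : rat) : X :=
  \ex e, z e :&: bp e (inr r).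

Lemma expL_lower z : is_lower (expL_val z).
Proof.
split=> [q q' u qq' uq|q u uq].
  apply: (joinE uq) => w wu.
    by move/tvE; apply=> q0; apply: joinIl; apply: tvI; exact: lt_trans q0.
  move/exE; apply=> e w' w'w /fle_meetP[we wq]; apply: joinIr.
  by apply: (@exI _ _ e); apply: meetI => //; apply: posLle wq; exact: ltW.
apply: (joinE uq) => w wu.
  move/tvE; apply=> q0; apply: (@exI _ _ (q / 2)).
  by apply: meetI; [apply: tvI | apply: joinIl; apply: tvI]; lra.
move/exE; apply=> e w' w'w /fle_meetP[we wq].
apply: (posLE wq) => q' w'' qq' w''w' wq'; ctx w''w'.
apply: (@exI _ _ q'); apply: meetI; first exact: tvI.
by apply: joinIr; apply: (@exI _ _ e); exact: meetI.
Qed.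

Lemma expL_neg z q u : q < 0 -> u |-- expL_val z q.
Proof. by move=> q0; apply: joinIl; exact: tvI. Qed.

Lemma expR_upper z : is_upper (expR_val z).
Proof.
split=> [q q' u qq' /exE|q u /exE]; apply=> e w wu /fle_meetP[we wq].
  by apply: (@exI _ _ e); apply: meetI => //; apply: posRle wq; exact: ltW.
apply: (posRE wq) => q' w' qq' w'w wq'; ctx w'w.
apply: (@exI _ _ q'); apply: meetI; first exact: tvI.
by apply: (@exI _ _ e); exact: meetI.
Qed.

Lemma expR_pos z r u : u |-- expR_val z r -> u |-- \tv (0 < r).
Proof.
move/exE; apply=> e w wu /fle_meetP[_ wr].
by apply: (posR_gt0 wr) => r0; exact: tvI.
Qed.

Definition expL (z : pt X LowerR) : pt X LowerNN :=
  mk_lowerNN (expL_lower z) (@expL_neg z).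

Definition expR (z : pt X UpperR) : pt X UpperNN :=
  mk_upperNN (expR_upper z) (@expR_pos z).

End Exponentiation.

Section Sections.
Variable X : space.

Definition left_sec (x : pt X RealT) : pt X LowerR :=
  @Pt X LowerR _ ((lower_satP _).2 (cutL (pt_is_cut x))).

Definition right_sec (x : pt X RealT) : pt X UpperR :=
  @Pt X UpperR _ ((upper_satP _).2 (cutR (pt_is_cut x))).

Definition left_sec_pos (x : pt X PosReal) : pt X LowerNN :=
  mk_lowerNN (cutL (gt_cut x)) (fun q u (q0 : q < 0) => posLle (ltW q0) (gt_pt x u)).

Definition right_sec_pos (x : pt X PosReal) : pt X UpperNN :=
  mk_upperNN (cutR (gt_cut x))
    (fun r u ur => cut_disj (gt_cut x) (gt_pt x u) ur).

Variable b : pt X GtOneReal.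

(* The Dedekind real b ^ z has sections b ^ (left section of z) and
   b ^ (right section of z). *)
Definition expD_val (z : pt X RealT) (a : rat + rat) : X :=
  match a with
  | inl q => expL b (left_sec z) q
  | inr r => expR b (right_sec z) r
  end.

Lemma expD_cut z : is_cut (expD_val z).
Proof.
have b1 u : u |-- gt1_pos b (inl 1) by exact: gt_pt.
have zc := pt_is_cut z.
split.
- exact: expL_lower.
- exact: expR_upper.
- by move=> u; apply: (@exI _ _ (-1)); apply: expL_neg.
- move=> u; apply: exE (cut_inhR zc u) _ => e w wu we.
  apply: (pos_inhR (x := rpow (gt1_pos b) e)) => r w' w'w wr; ctx w'w.
  by apply: (@exI _ _ r); apply: (@exI _ _ e); exact: meetI.
- move=> q r u uq ur; apply: exE ur _ => e w wu /fle_meetP[we wr].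
  apply: (posR_gt0 wr) => r0.
  apply: (joinE (fle_trans wu uq)) => w' w'w.
    by move/tvE; apply=> q0; apply: tvI; exact: lt_trans r0.
  move/exE; apply=> e' w'' w''w' /fle_meetP[we' wq]; ctx w'w; ctx w''w'.
  apply: tvE (cut_disj zc we' we) _ => e'e.
  by apply: (pos_disj (rpow_monoL (b1 _) e'e wq) wr) => qr; exact: tvI.
- move=> q r u qr; have [q0|q0] := ltP q 0; first by apply: joinIl; exact: expL_neg.
  pose q1 := (2 * q + r) / 3; pose q2 := (q + 2 * r) / 3.
  have q10 : 0 < q1 by rewrite /q1; lra.
  have qq1 : q < q1 by rewrite /q1; lra.
  have q12 : q1 < q2 by rewrite /q1 /q2; lra.
  have q20 : 0 < q2 by lra.
  have q2r : q2 < r by rewrite /q2; lra.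
  apply: (rpow_dense (b1 u) q10 q12) => e w wu e1 e2; ctx wu.
  apply: (rpow_dense (b1 w) q20 q2r) => e' w' w'w e1' e2'; ctx w'w.
  have [ee'|e'e] := ltP e e'; last first.
    have := posLle (lexx _) e1'; case: (ltrgtP e' e) e'e => // [e'e _ _|-> _ H].
      by apply: (pos_disj (rpow_monoL (b1 _) e'e e1') e2); rewrite ltxx.
    by apply: (pos_disj H e2); rewrite ltxx.
  apply: joinE (cut_loc zc w' ee') _ _ => v vw' ve; ctx vw'.
    apply: joinIl; apply: joinIr; apply: (@exI _ _ e); apply: meetI => //.
    by apply: posLle e1; exact: ltW.
  by apply: joinIr; apply: (@exI _ _ e'); exact: meetI.
Qed.

Lemma expD_gt0 z u : u |-- expD_val z (inl 0).
Proof.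
apply: exE (cut_inhL (pt_is_cut z) u) _ => e w wu we.
by apply: joinIr; apply: (@exI _ _ e); apply: meetI => //; exact: gt_pt.
Qed.

Definition expD (z : pt X RealT) : pt X PosReal := mk_pos (expD_cut z) (expD_gt0 z).

End Sections.

(* Pulling back along a map of stages commutes with the constructions above,
   so the maps below compute them on all generalised points. *)

Section Naturality.
Variables (X Y : space) (f : smap X Y).

Lemma hom_tv (P : Prop) : f (\tv P) = \tv P.
Proof.
rewrite /ftruth hom_sup; congr fsup; apply/funext => w; apply/propext; split.
  by case=> _ [p ->] ->; split; rewrite ?hom_top.
by case=> p ->; exists ftop; rewrite ?hom_top.
Qed.

Lemma hom_ex (I : Type) (g : I -> Y) : f (\ex i, g i) = \ex i, f (g i).
Proof.
rewrite /fexists hom_sup; congr fsup; apply/funext => w; apply/propext; split.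
  by case=> _ [i ->] ->; exists i.
by case=> i ->; exists (g i) => //; exists i.
Qed.

Lemma hom_join (u v : Y) : f (u :|: v) = f u :|: f v.
Proof.
rewrite /fjoin hom_sup; congr fsup; apply/funext => w; apply/propext; split.
  by case=> _ [->|->] ->; [left | right].
by case=> ->; [exists u | exists v] => //; [left | right].
Qed.

Lemma eq_ex (I : Type) (g h : I -> X) : g =1 h -> (\ex i, g i) = (\ex i, h i).
Proof. by move=> /funext->. Qed.

Lemma pull_one : pull f (pone Y) = pone X.
Proof. by apply: pt_ext => -[q|q]; exact: hom_tv. Qed.

Lemma pull_mul x y : pull f (mul x y) = mul (pull f x) (pull f y).
Proof.
apply: pt_ext => -[q|q]; rewrite [LHS]hom_ex; apply: eq_ex => s;
  by rewrite hom_ex; apply: eq_ex => t; rewrite !hom_meet hom_tv.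
Qed.

Lemma pull_inv x : pull f (inv x) = inv (pull f x).
Proof.
apply: pt_ext => -[q|q]; rewrite [LHS]hom_ex; apply: eq_ex => s;
  by rewrite !hom_meet hom_tv.
Qed.

Lemma pull_pow x n : pull f (pow x n) = pow (pull f x) n.
Proof. by elim: n => [|n IH]; [exact: pull_one | rewrite powS pull_mul IH]. Qed.

Lemma pull_root x n (n0 : (0 < n)%N) : pull f (nth_root x n0) = nth_root (pull f x) n0.
Proof. by apply: root_uniq; rewrite -pull_pow rootK. Qed.

Lemma pull_rpow x q : pull f (rpow x q) = rpow (pull f x) q.
Proof.
by rewrite /rpow; case: ifP => _; rewrite ?pull_inv pull_root pull_pow.
Qed.

Lemma pull_rpow_gt1 b q a :
  f (rpow (gt1_pos b) q a) = rpow (gt1_pos (pull f b)) q a.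
Proof.
have -> : gt1_pos (pull f b) = pull f (gt1_pos b) by exact: pt_ext.
by rewrite -pull_rpow.
Qed.

Lemma pull_expL b z : pull f (expL b z) = expL (pull f b) (pull f z).
Proof.
apply: pt_ext => q; rewrite [LHS]hom_join hom_tv hom_ex.
by congr fjoin; apply: eq_ex => e; rewrite hom_meet pull_rpow_gt1.
Qed.

Lemma pull_expR b z : pull f (expR b z) = expR (pull f b) (pull f z).
Proof.
apply: pt_ext => q; rewrite [LHS]hom_ex.
by apply: eq_ex => e; rewrite hom_meet pull_rpow_gt1.
Qed.

Lemma pull_expD b z : pull f (expD b z) = expD (pull f b) (pull f z).
Proof.
apply: pt_ext => -[q|q]; rewrite /=.
- have := congr1 (fun p : pt X LowerNN => p q) (pull_expL b (left_sec z)).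
  by have -> : pull f (left_sec z) = left_sec (pull f z) by exact: pt_ext.
- have := congr1 (fun p : pt X UpperNN => p q) (pull_expR b (right_sec z)).
  by have -> : pull f (right_sec z) = right_sec (pull f z) by exact: pt_ext.
Qed.

End Naturality.


Definition left_map : smap (Sp RealT) (Sp LowerR) :=
  classify (left_sec (generic RealT)).

Definition right_map : smap (Sp RealT) (Sp UpperR) :=
  classify (right_sec (generic RealT)).

Definition left_pos_map : smap (Sp PosReal) (Sp LowerNN) :=
  classify (left_sec_pos (generic PosReal)).

Definition right_pos_map : smap (Sp PosReal) (Sp UpperNN) :=
  classify (right_sec_pos (generic PosReal)).

Definition exp_lower : map_over GtOneReal LowerR LowerNN :=
  classify (expL (pt_fst (generic (prodT GtOneReal LowerR)))
                 (pt_snd (generic (prodT GtOneReal LowerR)))).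

Definition exp_upper : map_over GtOneReal UpperR UpperNN :=
  classify (expR (pt_fst (generic (prodT GtOneReal UpperR)))
                 (pt_snd (generic (prodT GtOneReal UpperR)))).

Definition exp_real : map_over GtOneReal RealT PosReal :=
  classify (expD (pt_fst (generic (prodT GtOneReal RealT)))
                 (pt_snd (generic (prodT GtOneReal RealT)))).

(* Main.v *)
Require Import Defs.
From mathcomp Require Import all_boot.
From mathcomp Require Import order ssralg ssrnum rat lra.
Set Implicit Arguments.
Unset Strict Implicit.
Unset Printing Implicit Defensive.
(* Defs is imported again because Order.TTheory shadows joinIl and joinIr. *)
Import Order.TTheory GRing.Theory Num.Theory Defs.
Local Open Scope ring_scope.
Local Open Scope frame_scope.

(** On a lower real [y], [q < log_b y] holds iff [b^q < r < y] for some rational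
    [r]; dually for upper reals.  Besides monotonicity of the rational powers of
    [b], two facts make this inverse to exponentiation: the powers [b^e] are
    dense among the positive reals ([rpow_dense]), and for [q < e] a rational
    separates [b^q] from [b^e] ([rpow_sep]).  All constructions commute with
    change of stage, so identities of generalised points are identities of maps. *)

(** * Order properties of rational powers *)

Section RationalPowersOrder.
Variable X : space.
Implicit Types (x : pt X PosReal) (q r s t e : rat) (u w : X).

(** The factor [x^(e'-e)] exceeds some rational [t > 1]. Once [x^e] is trapped between [s] and
    [d^2 s] with [d^2 < t], the rational [d^2 s] separates, since [d^2 s < s t < x^e x^(e'-e)]. *)
Lemma rpow_sep x e e' u c : u |-- x (inl 1) -> e < e' ->
  (forall r w, w |-- u -> w |-- rpow x e (inr r) -> w |-- rpow x e' (inl r) ->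
    w |-- c) -> u |-- c.
Proof.
move=> ux ee' Hc.
have : u |-- rpow x (e' - e) (inl 1) by apply: rpow_gt1; rewrite ?subr_gt0.
move=> /posLE; apply=> t w t1 wu wt.
have [d d1 dt] := pow_near1 2 t1; have d0 : 0 < d by lra.
apply: (pos_mloc (x := rpow x e) d1) => s w' s0 w'w ws wds.
apply: (Hc (d * d * s)) => //; first exact: fle_trans w'w wu.
move: (fle_trans w'w wt) => {}wt.
have -> : e' = e + (e' - e) by rewrite addrC subrK.
by rewrite rpow_add; apply: mulLI ws wt; rewrite // ?[s * t]mulrC; [lra|rewrite ltr_pM2r].
Qed.

Lemma rpow_lt_reflect x e e' r u : u |-- x (inl 1) ->
  u |-- rpow x e (inr r) -> u |-- rpow x e' (inl r) -> u |-- \tv (e < e').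
Proof.
move=> ux ur ur'; have [ee'|] := ltP e e'; first exact: tvI.
rewrite le_eqVlt => /orP[/eqP E|e'e].
  by rewrite E in ur'; apply: (pos_disj ur' ur); rewrite ltxx.
by apply: (pos_disj (rpow_monoL ux e'e ur') ur); rewrite ltxx.
Qed.

(** Locatedness turns [rpow_monoL] into its dual: for [r' < r] still above [x^e'], the alternative
    [r' < x^e] would give [r' < x^e']. *)
Lemma rpow_monoR x e e' r u : u |-- x (inl 1) -> e < e' ->
  u |-- rpow x e' (inr r) -> u |-- rpow x e (inr r).
Proof.
move=> ux ee' /posRE; apply=> r' w r'r wu wr; ctx wu.
apply: (pos_loc (x := rpow x e) r'r) => // w' w'w wr'; ctx w'w.
by apply: (pos_disj (rpow_monoL ux ee' wr') wr); rewrite ltxx.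
Qed.

End RationalPowersOrder.

(** * One-sided logarithms *)

Section Logarithm.
Variables (X : space) (b : pt X GtOneReal).
Implicit Types (q r s t e : rat) (u w : X).

Local Notation bp e := (rpow (gt1_pos b) e).

Let b1 u : u |-- gt1_pos b (inl 1).
Proof. exact: gt_pt. Qed.

Definition logL_val (y : pt X LowerNN) (q : rat) : X :=
  \ex r, y r :&: bp q (inr r).

Definition logR_val (y : pt X UpperNN) (q : rat) : X :=
  \ex r, y r :&: bp q (inl r).

Lemma lowerNN_lower (y : pt X LowerNN) : is_lower y.
Proof. exact: pt_is_lower (sub_pt y). Qed.

Lemma upperNN_upper (y : pt X UpperNN) : is_upper y.
Proof. exact: pt_is_upper (sub_pt y). Qed.

Lemma logL_lower y : is_lower (logL_val y).
Proof.
split=> [q q' u qq' /exE|q u /exE]; apply=> r w wu /fle_meetP[wr wq].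
  by apply: (@exI _ _ r); apply: meetI => //; exact: rpow_monoR wq.
apply: exE (lowerR (lowerNN_lower y) wr) _ => r' w' w'w /fle_meetP[/tvE h wr'].
apply: h => rr'; ctx w'w; apply: (posR_gt0 wq) => r0.
(* From [b^q < r < b^e < r'] it follows that [q < e], and [r'] witnesses [e]. *)
apply: (rpow_dense (b1 w') r0 rr') => e v vw' er er'; ctx vw'.
apply: (@exI _ _ e); apply: meetI; first exact: rpow_lt_reflect wq er.
by apply: (@exI _ _ r'); exact: meetI.
Qed.

Lemma logR_upper y : is_upper (logR_val y).
Proof.
split=> [q q' u qq' /exE|q u /exE]; apply=> r w wu /fle_meetP[wr wq].
  by apply: (@exI _ _ r); apply: meetI => //; exact: rpow_monoL wq.
apply: exE (upperR (upperNN_upper y) wr) _ => r' w' w'w /fle_meetP[/tvE h wr'].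
(* Density needs a positive lower bound: here an axiom of [UpperNN] gives it, whereas for lower
   reals it came from [b^q < r]. *)
apply: h => rr'; ctx w'w; apply: tvE (upperNN_pos wr') _ => r0.
apply: (rpow_dense (b1 w') r0 rr') => e v vw' er er'; ctx vw'.
apply: (@exI _ _ e); apply: meetI; first exact: rpow_lt_reflect er' wq.
by apply: (@exI _ _ r'); exact: meetI.
Qed.

Definition logL (y : pt X LowerNN) : pt X LowerR :=
  @Pt X LowerR _ ((lower_satP _).2 (logL_lower y)).

Definition logR (y : pt X UpperNN) : pt X UpperR :=
  @Pt X UpperR _ ((upper_satP _).2 (logR_upper y)).

Lemma expLK (z : pt X LowerR) : logL (expL b z) = z.
Proof.
have zL := pt_is_lower z.
apply: pt_ext => q; apply: fle_anti.
  apply: exE (fle_refl _) _ => r w _ /fle_meetP[wr wq].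
  apply: (posR_gt0 wq) => r0; apply: (joinE wr) => v vw.
    (* A negative [r] is excluded by [0 < b^q < r]. *)
    by move/tvE; apply=> /(lt_trans r0); rewrite ltxx.
  move/exE; apply=> e v' v'v /fle_meetP[ve vr]; ctx vw; ctx v'v.
  by apply: tvE (rpow_lt_reflect (b1 v') wq vr) _ => qe; exact: lowerD qe ve.
apply: exE (lowerR zL (fle_refl _)) _ => e w _ /fle_meetP[/tvE h we].
apply: h => qe; apply: (rpow_sep (b1 w) qe) => r v vw vq ve; ctx vw.
apply: (@exI _ _ r); apply: meetI => //.
by apply: joinIr; apply: (@exI _ _ e); exact: meetI.
Qed.

Lemma expRK (z : pt X UpperR) : logR (expR b z) = z.
Proof.
have zR := pt_is_upper z.
apply: pt_ext => q; apply: fle_anti.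
  apply: exE (fle_refl _) _ => r w _ /fle_meetP[wr wq].
  apply: (exE wr) => e v vw /fle_meetP[ve vr]; ctx vw.
  by apply: tvE (rpow_lt_reflect (b1 v) vr wq) _ => eq; exact: upperD eq ve.
apply: exE (upperR zR (fle_refl _)) _ => e w _ /fle_meetP[/tvE h we].
apply: h => eq; apply: (rpow_sep (b1 w) eq) => r v vw vq ve; ctx vw.
apply: (@exI _ _ r); apply: meetI => //.
by apply: (@exI _ _ e); exact: meetI.
Qed.

Lemma logLK (y : pt X LowerNN) : expL b (logL y) = y.
Proof.
have yL := lowerNN_lower y.
apply: pt_ext => q; apply: fle_anti.
  apply: joinE (fle_refl _) _ _ => w _.
    by move/tvE; apply=> q0; exact: lowerNN_neg.
  move/exE; apply=> e v vw /fle_meetP[ve vq].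
  apply: (exE ve) => r v' v'v /fle_meetP[vr er]; ctx v'v.
  by apply: (pos_disj vq er) => qr; exact: lowerD qr vr.
have [q0|q0] := ltP q 0; first by apply: joinIl; exact: tvI.
apply: exE (lowerR yL (fle_refl _)) _ => r w _ /fle_meetP[/tvE h wr].
apply: h => qr.
(* [q] may be 0, so the midpoint serves as the positive lower bound for density. *)
have m0 : 0 < (q + r) / 2 by lra.
have mr : (q + r) / 2 < r by lra.
apply: (rpow_dense (b1 w) m0 mr) => e v vw em er; ctx vw.
apply: joinIr; apply: (@exI _ _ e); apply: meetI.
  by apply: (@exI _ _ r); exact: meetI.
by apply: posLle em; lra.
Qed.

Lemma logRK (y : pt X UpperNN) : expR b (logR y) = y.
Proof.
have yR := upperNN_upper y.
apply: pt_ext => q; apply: fle_anti.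
  apply: exE (fle_refl _) _ => e v _ /fle_meetP[ve vq].
  apply: (exE ve) => r v' v'v /fle_meetP[vr er]; ctx v'v.
  by apply: (pos_disj er vq) => rq; exact: upperD rq vr.
apply: exE (upperR yR (fle_refl _)) _ => r w _ /fle_meetP[/tvE h wr].
apply: h => rq; apply: tvE (upperNN_pos wr) _ => r0.
apply: (rpow_dense (b1 w) r0 rq) => e v vw er eq; ctx vw.
apply: (@exI _ _ e); apply: meetI => //.
by apply: (@exI _ _ r); exact: meetI.
Qed.

(** * The logarithm of a positive Dedekind real *)

Definition logD_val (y : pt X PosReal) (a : rat + rat) : X :=
  match a with
  | inl q => logL (left_sec_pos y) q
  | inr r => logR (right_sec_pos y) r
  end.

Lemma logD_cut y : is_cut (logD_val y).
Proof.
split.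
- exact: logL_lower.
- exact: logR_upper.
- move=> u; apply: (pos_inhL (x := y)) => s w s0 wu ws.
  have h0 : 0 < s / 2 by lra.
  have hs : s / 2 < s by lra.
  apply: (rpow_dense (b1 w) h0 hs) => e v vw _ es; ctx vw.
  by apply: (@exI _ _ e); apply: (@exI _ _ s); exact: meetI.
- move=> u; apply: (pos_inhR (x := y)) => s w wu ws.
  apply: (posR_gt0 ws) => s0; have s1 : s < s + 1 by lra.
  apply: (rpow_dense (b1 w) s0 s1) => e v vw es _; ctx vw.
  by apply: (@exI _ _ e); apply: (@exI _ _ s); exact: meetI.
- move=> q r u uq ur; apply: (exE uq) => s w wu /fle_meetP[ys qs]; ctx wu.
  apply: (exE ur) => t v vw /fle_meetP[yt tr]; ctx vw.
  apply: (pos_disj ys yt) => st.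
  by apply: (rpow_lt_reflect (b1 v)) tr; exact: posRle (ltW st) qs.
- move=> q r u qr; apply: (rpow_sep (b1 u) qr) => s w wu qs sr.
  (* Locating [y] takes two rationals, so [s] is pushed up to [s'], still below [b^r]. *)
  apply: (posLE sr) => s' v ss' vw sr'; ctx vw.
  apply: (pos_loc (x := y) ss') => v' v'v ys; ctx v'v.
    by apply: joinIl; apply: (@exI _ _ s); exact: meetI.
  by apply: joinIr; apply: (@exI _ _ s'); exact: meetI.
Qed.

Definition logD (y : pt X PosReal) : pt X RealT := mk_real (logD_cut y).

(** This reduces to the one-sided inverses: the sections of [expD b z] have the same values as the
    one-sided exponentials, and only the proofs of the axioms differ. *)
Lemma expDK (z : pt X RealT) : logD (expD b z) = z.
Proof.
apply: pt_ext => -[q|r].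
- have := congr1 (fun p : pt X LowerR => p q) (expLK (left_sec z)).
  by have -> : expL b (left_sec z) = left_sec_pos (expD b z) by exact: pt_ext.
- have := congr1 (fun p : pt X UpperR => p r) (expRK (right_sec z)).
  by have -> : expR b (right_sec z) = right_sec_pos (expD b z) by exact: pt_ext.
Qed.

Lemma logDK (y : pt X PosReal) : expD b (logD y) = y.
Proof.
apply: pt_ext => -[q|r].
- have := congr1 (fun p : pt X LowerNN => p q) (logLK (left_sec_pos y)).
  by have -> : logL (left_sec_pos y) = left_sec (logD y) by exact: pt_ext.
- have := congr1 (fun p : pt X UpperNN => p r) (logRK (right_sec_pos y)).
  by have -> : logR (right_sec_pos y) = right_sec (logD y) by exact: pt_ext.
Qed.

End Logarithm.

(** * Stability under change of stage *)

Section LogNaturality.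
Variables (X Y : space) (f : smap X Y).

(** Only joins, finite meets and rational powers of [b] enter, all preserved by [f]. *)
Lemma pull_logL b y : pull f (logL b y) = logL (pull f b) (pull f y).
Proof.
apply: pt_ext => q; rewrite [LHS]hom_ex.
by apply: eq_ex => r; rewrite hom_meet pull_rpow_gt1.
Qed.

Lemma pull_logR b y : pull f (logR b y) = logR (pull f b) (pull f y).
Proof.
apply: pt_ext => q; rewrite [LHS]hom_ex.
by apply: eq_ex => r; rewrite hom_meet pull_rpow_gt1.
Qed.

Lemma pull_logD b y : pull f (logD b y) = logD (pull f b) (pull f y).
Proof.
apply: pt_ext => -[q|q].
- have := congr1 (fun p : pt X LowerR => p q) (pull_logL b (left_sec_pos y)).
  by have -> : pull f (left_sec_pos y) = left_sec_pos (pull f y) by exact: pt_ext.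
- have := congr1 (fun p : pt X UpperR => p q) (pull_logR b (right_sec_pos y)).
  by have -> : pull f (right_sec_pos y) = right_sec_pos (pull f y) by exact: pt_ext.
Qed.

End LogNaturality.

(* By the Yoneda lemma, an operation on generalised points that is stable under
   change of stage amounts to a map over S: this is how a geometric construction
   of points is read as a map. *)
Definition construction (S A B : theory) :=
  forall X : space, pt X S -> pt X A -> pt X B.

Definition natural (S A B : theory) (K : construction S A B) : Prop :=
  forall (X Y : space) (f : smap X Y) s a,
    pull f (K Y s a) = K X (pull f s) (pull f a).

Definition map_of (S A B : theory) (K : construction S A B) : map_over S A B :=
  classify (K _ (pt_fst (generic (prodT S A))) (pt_snd (generic (prodT S A)))).

Lemma pull_classify (X : space) (T : theory) (p : pt X T) :
  pull (classify p) (generic T) = p.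
Proof. by apply: pt_ext => a; exact: classify_atom. Qed.

(** Composition becomes substitution: naturality along the pairing map carries the generic pair to
    the base point together with [p]. *)
Lemma comp_over_map_of (S A B C : theory) (K : construction S B C)
    (p : pt (Sp (prodT S A)) B) : natural K ->
  comp_over (map_of K) (classify p) =
    classify (K _ (pt_fst (generic (prodT S A))) p).
Proof.
move=> natK; apply: map_eqP => c; rewrite [LHS]scompE !classify_atom.
set f := pair_map _ _.
have := congr1 (fun t : pt _ C => t c) (natK _ _ f
  (pt_fst (generic (prodT S B))) (pt_snd (generic (prodT S B)))).
have -> : pull f (pt_fst (generic (prodT S B))) = pt_fst (generic (prodT S A)).
  apply: pt_ext => a; rewrite -[RHS](classify_atom (pt_fst _)).
  exact: (@classify_atom _ _ (pt_pair _ _) (inl a)).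
have -> // : pull f (pt_snd (generic (prodT S B))) = p.
apply: pt_ext => a; rewrite -[RHS](classify_atom p).
exact: (@classify_atom _ _ (pt_pair _ _) (inr a)).
Qed.

(** After substitution both composites classify the generic second component, which is the identity
    over [S]. *)
Lemma inverse_over_map_of (S A B : theory) (K : construction S A B)
    (H : construction S B A) : natural K -> natural H ->
  (forall X s, cancel (H X s) (K X s)) -> (forall X s, cancel (K X s) (H X s)) ->
  inverse_over (map_of K) (map_of H).
Proof. by move=> nK nH HK KH; split; rewrite comp_over_map_of // ?HK ?KH. Qed.

(* The variable b is the generic point of the base space (1, oo), presented by
   GtOneReal: a map A -> B for fixed b is a map (1, oo) * A -> B. *)
Theorem theorem4p2 :
  exists (log_lower : map_over GtOneReal LowerNN LowerR)
         (log_upper : map_over GtOneReal UpperNN UpperR)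
         (log_real : map_over GtOneReal PosReal RealT),
    [/\ inverse_over log_lower exp_lower,
        inverse_over log_upper exp_upper,
        scomp left_map log_real =
          comp_over log_lower (const_over GtOneReal left_pos_map),
        scomp right_map log_real =
          comp_over log_upper (const_over GtOneReal right_pos_map)
      & inverse_over log_real exp_real].
Proof.
exists (map_of logL), (map_of logR), (map_of logD); split.
- apply: (@inverse_over_map_of _ _ _ logL expL); move=> *;
    [exact: pull_logL | exact: pull_expL | exact: expLK | exact: logLK].
- apply: (@inverse_over_map_of _ _ _ logR expR); move=> *;
    [exact: pull_logR | exact: pull_expR | exact: expRK | exact: logRK].
(* As a classifying map, the left section can be substituted into [logL]; the result is the left
   section of [logD] by definition. *)
- have -> : const_over GtOneReal left_pos_map =
      classify (left_sec_pos (pt_snd (generic (prodT GtOneReal PosReal)))).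
    by apply: map_eqP => q; rewrite [LHS]scompE !classify_atom.
  rewrite comp_over_map_of; last by move=> *; exact: pull_logL.
  by apply: map_eqP => q; rewrite [LHS]scompE !classify_atom.
- have -> : const_over GtOneReal right_pos_map =
      classify (right_sec_pos (pt_snd (generic (prodT GtOneReal PosReal)))).
    by apply: map_eqP => q; rewrite [LHS]scompE !classify_atom.
  rewrite comp_over_map_of; last by move=> *; exact: pull_logR.
  by apply: map_eqP => q; rewrite [LHS]scompE !classify_atom.
- apply: (@inverse_over_map_of _ _ _ logD expD); move=> *;
    [exact: pull_logD | exact: pull_expD | exact: expDK | exact: logDK].
Qed.
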